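(* For all positive integers $m,n$, $$|MS^2|=\pm|MP|^3\,\operatorname{Res}_{m,n}(x_1,x_2,x_3).$$
   Context: Let $m,n\ge 1$ and let $x_i(s,u;t,v)=\sum_{j=0}^m\sum_{k=0}^n c^i_{jk}s^ju^{m-j}t^kv^{n-k}$, $i=1,\dots,4$, be four generic bihomogeneous polynomials of bi-degree $(m,n)$ (the $c^i_{jk}$ are independent indeterminates). Let $\mathbb{K}=\mathbb{Q}(c^i_{jk})$, and let $S_{k,l}$ be the $\mathbb{K}$-space of bihomogeneous polynomials of bi-degree $(k,l)$ in $(s,u;t,v)$. All spaces have monomial bases, each with a fixed order, and matrices are taken in these bases. $|A|$ denotes the determinant of a square matrix $A$. $MP$ is the (square, size $4mn$) matrix of $\phi:S_{m-1,n-1}^4\to S_{2m-1,2n-1}$, $(p_1,p_2,p_3,p_4)\mapsto\sum_{i=1}^4p_ix_i$. Let $\Gamma_0=\{\gamma\in\mathbb{Z}_{\ge0}^4:|\gamma|=2,\ \gamma_4\le1\}$ (9 elements) and $x^\gamma=x_1^{\gamma_1}x_2^{\gamma_2}x_3^{\gamma_3}x_4^{\gamma_4}$. $MS^2$ is the (square, size $9mn$) matrix of $\psi^2:S_{m-1,n-1}^{\Gamma_0}\to S_{3m-1,3n-1}$, $(p_\gamma)\mapsto\sum_{\gamma\in\Gamma_0}p_\gamma x^\gamma$. $\operatorname{Res}_{m,n}(f_1,f_2,f_3)$ is the bihomogeneous resultant of three generic polynomials of bi-degree $(m,n)$: the irreducible polynomial with integer coefficients (unique up to sign) in the coefficients of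 the $f_i$ which vanishes, after specializing the coefficients in a field $k$, if and only if $f_1=f_2=f_3=0$ has a solution in $\mathbb{P}^1_{\overline k}\times\mathbb{P}^1_{\overline k}$. *)

(* Defs.v *)
From HB Require Import structures.
From mathcomp Require Import all_boot all_order all_algebra.
From mathcomp Require Import mpoly.

Set Implicit Arguments.
Unset Strict Implicit.
Unset Printing Implicit Defensive.

Import GRing.Theory.
Local Open Scope ring_scope.

(* Polynomials in (s,u;t,v) over A are {mpoly A[4]}; variables 0, 1, 2, 3 are
   s, u, t, v. *)

Notation bidx k l := ('I_k.+1 * 'I_l.+1)%type.

(* The exponent of s^a u^(k-a) t^b v^(l-b). *)
Definition bimon (k l : nat) (ab : bidx k l) : 'X_{1..4} :=
  [multinom [tuple nat_of_ord ab.1; (k - ab.1)%N; nat_of_ord ab.2; (l - ab.2)%N]].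

(* The space S_{k,l}; its monomial basis is the family of the 'X_[bimon ab],
   see [bihomogE]. *)
Definition bihomog (A : nzRingType) (k l : nat) (p : {mpoly A[4]}) : bool :=
  all (fun w : 'X_{1..4} =>
         (w (inord 0) + w (inord 1) == k)%N && (w (inord 2) + w (inord 3) == l)%N)
      (msupp p).

Definition bipoly (A : nzRingType) (m n : nat) (a : 'I_m.+1 -> 'I_n.+1 -> A) :
    {mpoly A[4]} :=
  \sum_(j < m.+1) \sum_(k < n.+1) a j k *: 'X_[bimon (j, k)].

Definition cidx (r m n : nat) : finType := ('I_r * 'I_m.+1 * 'I_n.+1)%type.

(* The field Q(c^i_jk); mpoly variables are numbered, so the triple (i, j, k)
   is encoded by its rank in the enumeration of [cidx 4 m n]. *)
Definition coefK (m n : nat) : fieldType :=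
  {fraction {mpoly rat[#|cidx 4 m n|]}}.

Definition coefc (m n : nat) (i : 'I_4) (j : 'I_m.+1) (k : 'I_n.+1) : coefK m n :=
  tofrac ('X_(enum_rank ((i, j, k) : cidx 4 m n)) : {mpoly rat[#|cidx 4 m n|]}).

Definition gpoly (m n : nat) (i : 'I_4) : {mpoly (coefK m n)[4]} :=
  bipoly (@coefc m n i).

Definition phi (m n : nat) (p : 'I_4 -> {mpoly (coefK m n)[4]}) :
    {mpoly (coefK m n)[4]} :=
  \sum_(i < 4) p i * gpoly m n i.

Definition Gamma0 : finType :=
  {g : 'X_{1..4 < 3} | (mdeg g == 2)%N && (bmnm g ord_max <= 1)%N}.

Definition gpolyX (m n : nat) (g : Gamma0) : {mpoly (coefK m n)[4]} :=
  \prod_(i < 4) gpoly m n i ^+ bmnm (val g) i.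

Definition psi2 (m n : nat) (p : Gamma0 -> {mpoly (coefK m n)[4]}) :
    {mpoly (coefK m n)[4]} :=
  \sum_(g : Gamma0) p g * gpolyX m n g.

(* The monomial basis of the space S_{k,l}^I of I-indexed families. *)
Definition fammon (A : nzRingType) (I : eqType) (k l : nat) (e : I * bidx k l)
    (i : I) : {mpoly A[4]} :=
  if i == e.1 then 'X_[bimon e.2] else 0.

(* The orders of the bases are given by enumerations: [dom] lists the basis of
   the source (columns) and [cod] the basis of the target (rows).  [MP_col] and
   [MS2_col] show that these are the matrices of [phi] and [psi2]. *)
Definition MP (m n : nat) (dom : 'I_(4 * m * n) -> 'I_4 * bidx m.-1 n.-1)
    (cod : 'I_(4 * m * n) -> bidx (2 * m).-1 (2 * n).-1) :
    'M[coefK m n]_(4 * m * n) :=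
  \matrix_(r, c) (phi (fammon (coefK m n) (dom c)))@_(bimon (cod r)).

Definition MS2 (m n : nat) (dom : 'I_(9 * m * n) -> Gamma0 * bidx m.-1 n.-1)
    (cod : 'I_(9 * m * n) -> bidx (3 * m).-1 (3 * n).-1) :
    'M[coefK m n]_(9 * m * n) :=
  \matrix_(r, c) (psi2 (fammon (coefK m n) (dom c)))@_(bimon (cod r)).

Definition irreducible_elt (D : idomainType) (p : D) : Prop :=
  [/\ p != 0, p \isn't a GRing.unit &
      forall a b : D, p = a * b -> a \is a GRing.unit \/ b \is a GRing.unit].

(* Value of an integer polynomial in the coefficients of three polynomials of
   bi-degree (m,n), the j k-th coefficient of the i-th one being [a i j k]. *)
Definition eval_coef (m n : nat) (A : comNzRingType) (F : {mpoly int[#|cidx 3 m n|]})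
    (a : 'I_3 -> 'I_m.+1 -> 'I_n.+1 -> A) : A :=
  mmap (fun z : int => z%:~R)
       (fun q => let ijk := enum_val q in a ijk.1.1 ijk.1.2 ijk.2) F.

Definition has_biproj_zero (L : fieldType) (r : nat) (f : 'I_r -> {mpoly L[4]}) : Prop :=
  exists s u t v : L,
    [/\ (s, u) != (0, 0), (t, v) != (0, 0) &
        forall i : 'I_r, (f i).@[tnth [tuple s; u; t; v]] = 0].

(* [iota] exhibits L as an algebraic closure of k. *)
Definition is_alg_closure (k : fieldType) (L : closedFieldType)
    (iota : {rmorphism k -> L}) : Prop :=
  forall z : L, algebraicOver iota z.

Definition is_biresultant (m n : nat) (F : {mpoly int[#|cidx 3 m n|]}) : Prop :=
  irreducible_elt F /\
  forall (k : fieldType) (L : closedFieldType) (iota : {rmorphism k -> L})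
         (a : 'I_3 -> 'I_m.+1 -> 'I_n.+1 -> k),
    is_alg_closure iota ->
    eval_coef F a = 0 <->
    has_biproj_zero (fun i => bipoly (fun j l => iota (a i j l))).

(* Res_{m,n}(x_1, x_2, x_3). *)
Definition res_gpoly (m n : nat) (F : {mpoly int[#|cidx 3 m n|]}) : coefK m n :=
  eval_coef F (fun i => @coefc m n (widen_ord (leqnSn 3) i)).

Lemma bihomogP (A : nzRingType) k l (p : {mpoly A[4]}) :
  reflect (forall w : 'X_{1..4}, w \in msupp p ->
            w (inord 0) + w (inord 1) = k /\ w (inord 2) + w (inord 3) = l)%N
          (bihomog k l p).
Proof.
apply: (iffP allP) => H w /H; first by case/andP => /eqP ? /eqP.
by case=> -> ->; rewrite !eqxx.
Qed.

Lemma bimon_inj k l : injective (@bimon k l).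
Proof.
move=> [a b] [a' b'] /mnmP H.
have := H (inord 2); have := H (inord 0).
rewrite !multinomE !(tnth_nth 0%N) !inordK //= => /ord_inj -> /ord_inj ->.
by [].
Qed.

Lemma bihomog_bimon (A : nzRingType) k l (ab : bidx k l) :
  bihomog k l ('X_[bimon ab] : {mpoly A[4]}).
Proof.
rewrite /bihomog msuppX /= !multinomE !(tnth_nth 0%N) !inordK //= andbT.
by rewrite !subnKC ?eqxx // leq_ord.
Qed.

Lemma bihomogE (A : nzRingType) k l (p : {mpoly A[4]}) :
  bihomog k l p -> p = \sum_(ab : bidx k l) p@_(bimon ab) *: 'X_[bimon ab].
Proof.
move/bihomogP => hp; apply/mpolyP => w; rewrite raddf_sum /=.
have [/hp [h1 h2]|hw] := boolP (w \in msupp p); last first.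
  rewrite memN_msupp_eq0 // big1 // => ab _.
  rewrite mcoeffZ mcoeffX; case: eqP => [->|]; last by rewrite mulr0.
  by rewrite memN_msupp_eq0 ?mul0r.
have la : (w (inord 0) < k.+1)%N by rewrite ltnS -h1 leq_addr.
have lb : (w (inord 2) < l.+1)%N by rewrite ltnS -h2 leq_addr.
have e : bimon (Ordinal la, Ordinal lb) = w.
  apply/mnmP => i; rewrite multinomE (tnth_nth 0%N) /=.
  rewrite -(inord_val i); case: i => [[|[|[|[|//]]]] hi] /=; rewrite ?inordK //=.
  - by rewrite -h1 addKn.
  - by rewrite -h2 addKn.
rewrite (bigD1 (Ordinal la, Ordinal lb)) //= e mcoeffZ mcoeffX eqxx mulr1.
rewrite big1 ?addr0 // => ab nab; rewrite mcoeffZ mcoeffX -{1}e.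
by rewrite (inj_eq (@bimon_inj _ _)) (negbTE nab) mulr0.
Qed.

Lemma bihomogD (A : nzRingType) k l (p q : {mpoly A[4]}) :
  bihomog k l p -> bihomog k l q -> bihomog k l (p + q).
Proof.
move=> /bihomogP hp /bihomogP hq; apply/bihomogP => w /msuppD_le.
by rewrite mem_cat => /orP[/hp|/hq].
Qed.

Lemma bihomog0 (A : nzRingType) k l : bihomog k l (0 : {mpoly A[4]}).
Proof. by rewrite /bihomog msupp0. Qed.

Lemma bihomogZ (A : nzRingType) k l c (p : {mpoly A[4]}) :
  bihomog k l p -> bihomog k l (c *: p).
Proof. by move=> /bihomogP hp; apply/bihomogP => w /msuppZ_le /hp. Qed.

Lemma bihomogM (A : nzRingType) k l k' l' (p q : {mpoly A[4]}) :
  bihomog k l p -> bihomog k' l' q -> bihomog (k + k') (l + l') (p * q).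
Proof.
move=> /bihomogP hp /bihomogP hq; apply/bihomogP => w /msuppM_le.
case/allpairsP => [[u v] /= [/hp [h1 h2] /hq [h3 h4] ->]].
by rewrite !mnmDE -h1 -h2 -h3 -h4; split; rewrite addnACA.
Qed.

Lemma bihomog_sum (A : nzRingType) k l (I : finType) (F : I -> {mpoly A[4]}) :
  (forall i, bihomog k l (F i)) -> bihomog k l (\sum_i F i).
Proof. by move=> h; elim/big_ind: _ => //; [exact: bihomog0|exact: bihomogD]. Qed.

Lemma bihomog_gpoly m n i : bihomog m n (gpoly m n i).
Proof.
apply: bihomog_sum => j; apply: bihomog_sum => k.
exact/bihomogZ/bihomog_bimon.
Qed.

Lemma bihomog_fammon (A : nzRingType) (I : eqType) k l (e : I * bidx k l) i :
  bihomog k l (fammon A e i).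
Proof. by rewrite /fammon; case: ifP => _; [exact: bihomog_bimon|exact: bihomog0]. Qed.

Lemma bihomog_phi m n p : (0 < m)%N -> (0 < n)%N ->
  (forall i, bihomog m.-1 n.-1 (p i)) ->
  bihomog (2 * m).-1 (2 * n).-1 (phi (m:=m) (n:=n) p).
Proof.
move=> hm hn h; apply: bihomog_sum => i.
have := bihomogM (h i) (bihomog_gpoly m n i).
have ar d : (0 < d)%N -> (d.-1 + d = (2 * d).-1)%N.
  by case: d => // d _; rewrite mul2n -addnn.
by rewrite !ar.
Qed.

Lemma bihomog_gpolyX m n g : bihomog (2 * m) (2 * n) (gpolyX m n g).
Proof.
have hX i k : bihomog (k * m) (k * n) (gpoly m n i ^+ k).
  elim: k => [|k IH]; last by rewrite exprS !mulSn; apply/bihomogM/IH/bihomog_gpoly.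
  by rewrite /bihomog msupp1 /= !mnm0E.
have e : \sum_(i < 4) bmnm (val g) i = 2%N by rewrite -mdegE; case/andP: (valP g) => /eqP.
rewrite -e !big_distrl /= /gpolyX.
elim/big_rec3: _ => [|i a b c _ IH]; first by rewrite /bihomog msupp1 /= !mnm0E.
exact: bihomogM.
Qed.

Lemma bihomog_psi2 m n p : (0 < m)%N -> (0 < n)%N ->
  (forall g, bihomog m.-1 n.-1 (p g)) ->
  bihomog (3 * m).-1 (3 * n).-1 (psi2 (m:=m) (n:=n) p).
Proof.
move=> hm hn h; apply: bihomog_sum => g.
have := bihomogM (h g) (bihomog_gpolyX m n g).
have ar d : (0 < d)%N -> (d.-1 + 2 * d = (3 * d).-1)%N.
  by case: d => // d _; rewrite (mulSn 2).
by rewrite !ar.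
Qed.

Lemma MP_col m n (hm : (0 < m)%N) (hn : (0 < n)%N) dom cod (hcod : bijective cod) c :
  phi (fammon (coefK m n) (dom c)) =
    \sum_r MP dom cod r c *: 'X_[bimon (cod r)].
Proof.
rewrite {1}(bihomogE (bihomog_phi hm hn (bihomog_fammon (coefK m n) (dom c)))).
rewrite (reindex cod) /=; last exact: onW_bij.
by apply: eq_bigr => r _; rewrite mxE.
Qed.

Lemma MS2_col m n (hm : (0 < m)%N) (hn : (0 < n)%N) dom cod (hcod : bijective cod) c :
  psi2 (fammon (coefK m n) (dom c)) =
    \sum_r MS2 dom cod r c *: 'X_[bimon (cod r)].
Proof.
rewrite {1}(bihomogE (bihomog_psi2 hm hn (bihomog_fammon (coefK m n) (dom c)))).
rewrite (reindex cod) /=; last exact: onW_bij.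
by apply: eq_bigr => r _; rewrite mxE.
Qed.

(* Main.v *)
From HB Require Import structures.
Require Import Defs.
From mathcomp Require Import all_boot all_order all_algebra.
From mathcomp Require Import mpoly.
From mathcomp Require Import perm ring zify all_field.
From Stdlib Require Import Classical.

Set Implicit Arguments.
Unset Strict Implicit.
Unset Printing Implicit Defensive.

Import GRing.Theory.
Import Num.Theory.
Local Open Scope ring_scope.

(** Let [D : S_{2m-1,2n-1}^3 -> S_{3m-1,3n-1}] be the multiplication by
    (x_1, x_2, x_3), and let [K] be the Koszul syzygies with coefficients in
    S_{m-1,n-1}.  Column operations turn three copies of [phi] into a matrix
    [(sigma | K)] such that [D sigma] is the matrix of [psi^2], while [D K = 0].
    Stacking [D] on a coordinate projection [p] of the source therefore gives
      [|(D, p)| |MP|^3 = +-|MS^2| |p K|].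
    A suitable [p] makes both [(D, p)] and [p K] block triangular with
    [|(D, p)| = +-|Syl| |p K|], where [Syl : S_{2m-1,n-1}^3 -> S_{3m-1,2n-1}] is
    again the multiplication by (x_1, x_2, x_3).

    It remains to identify [|Syl|] with the resultant.  [Syl] is injective when
    there is no common zero over an algebraic closure.  Let [e] be a system
    without common zero over any field: [|Syl|] is invertible modulo every prime
    at [e], hence +-1 there, so that [|Syl|(c + z e)] is monic in [z] up to sign.
    All its roots are roots of [Res(c + z e)], so [|Syl|] divides a power of
    [Res], which is prime because Z[c] is factorial.  Finally [Res^2] does not
    divide [|Syl|]: moving one coefficient of x_3, [|Syl|] has degree at most
    2mn while [Res] can be given 2mn distinct roots. *)

(** * Unique factorization in integer polynomial rings *)

(** The resultant is given only by its irreducibility over Z and its zero set, so |Syl| must be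
    identified from its zeros. Zeros over fields alone would leave an integer factor undetermined.
    The pencil c + z e removes it: division by a polynomial monic in z stays inside Z[c][z], and z =
    0 then makes |Syl| a divisor of a power of Res in Z[c] itself. Hence |Syl| = +-Res^k. Here k >
    0, because at a common zero the values of the monomials form a left kernel vector of Syl. And k
    < 2 by a count: 2mn is both the number of columns of Syl that come from x_3 and the number of
    points common to two general curves of bidegree (m,n).

    The Koszul identity holds over every commutative ring, but with |p K| on both sides. Cancelling
    it requires |p K| != 0 for generic coefficients, which is checked on two monomials. All
    determinants are taken up to sign: rows and columns are indexed by monomials, and the block
    decompositions constantly reorder them. *)

Definition divides (D : idomainType) (p x : D) := exists c, x = c * p.

Definition prime_elt (D : idomainType) (p : D) :=
  [/\ p != 0, p \isn't a GRing.unit &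
      forall a b, divides p (a * b) -> divides p a \/ divides p b].

Definition prime_product (D : idomainType) (x : D) :=
  exists u s, [/\ u \is a GRing.unit, forall p, p \in s -> prime_elt p
                & x = u * \prod_(p <- s) p].

(** Asking for prime rather than irreducible factors builds uniqueness into the definition, so that
    only existence has to be carried from D to D[X]. *)
Definition factorial_dom (D : idomainType) :=
  forall x : D, x != 0 -> prime_product x.

Lemma prime_productM (D : idomainType) (x y : D) :
  prime_product x -> prime_product y -> prime_product (x * y).
Proof.
move=> [u1 [s1 [U1 P1 ->]]] [u2 [s2 [U2 P2 ->]]].
exists (u1 * u2), (s1 ++ s2); rewrite unitrM U1 U2 big_cat mulrACA.
by split=> // p; rewrite mem_cat => /orP[/P1|/P2].
Qed.

Lemma dividesMl (D : idomainType) (p a b : D) : divides p b -> divides p (a * b).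
Proof. by case=> c ->; exists (a * c); rewrite mulrA. Qed.

Lemma dividesMr (D : idomainType) (p a b : D) : divides p a -> divides p (a * b).
Proof. by rewrite mulrC; exact: dividesMl. Qed.

Lemma dividesD (D : idomainType) (p a b : D) :
  divides p a -> divides p b -> divides p (a + b).
Proof. by case=> c -> [d ->]; exists (c + d); rewrite mulrDl. Qed.

Lemma dividesB (D : idomainType) (p a b : D) :
  divides p (a + b) -> divides p b -> divides p a.
Proof. by case=> c e [d f]; exists (c - d); rewrite mulrBl -e -f addrK. Qed.

(** In a prime factorization of an irreducible element, one prime takes everything but a unit, so
    the element is associate to that prime. *)
Lemma irreducible_prime (D : idomainType) (p : D) :
  factorial_dom D -> irreducible_elt p -> prime_elt p.
Proof.
move=> fD [p0 pU pI]; have [u [s [uU sP e]]] := fD _ p0.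
case: s => [|q s] in sP e; first by rewrite e big_nil mulr1 uU in pU.
have [q0 qU qP] := sP q (mem_head _ _).
rewrite big_cons mulrCA in e.
case: (pI _ _ e) => [|vU]; first by rewrite (negbTE qU).
split=> // a b [c h]; set v := u * _ in e vU.
have dp x : divides q x -> divides p x.
  by case=> d ->; exists (d / v); rewrite e (mulrC q) mulrA divrK.
have : divides q (a * b) by exists (c * v); rewrite h e -mulrA (mulrC v).
by case/qP=> /dp; [left|right].
Qed.

(** Each prime of [s] divides [g] or [h] and is cancelled there. This is the tool for clearing
    constant denominators in D[X]. *)
Lemma split_prime_factors (D : idomainType) (s : seq D) (f g h : D) :
  (forall p, p \in s -> prime_elt p) -> \prod_(p <- s) p * f = g * h ->
  exists s1 s2 g' h', [/\ perm_eq (s1 ++ s2) s, g = g' * \prod_(p <- s1) p,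
    h = h' * \prod_(p <- s2) p & f = g' * h'].
Proof.
elim: s g h => [|p s IH] g h sP.
  rewrite big_nil mul1r => ->; exists [::], [::], g, h.
  by rewrite !big_nil !mulr1.
rewrite big_cons -mulrA => e.
have [p0 _ pP] := sP p (mem_head _ _).
have sP' q : q \in s -> prime_elt q by move=> qs; apply: sP; rewrite inE qs orbT.
have /pP : divides p (g * h) by exists (\prod_(j <- s) j * f); rewrite -e mulrC.
case=> -[c ec]; subst.
- have /(IH _ _ sP') : \prod_(j <- s) j * f = c * h.
    by apply: (mulfI p0); rewrite e mulrA (mulrC p).
  move=> [s1 [s2 [g' [h' [sE -> -> ->]]]]].
  exists (p :: s1), s2, g', h'; split=> //=; first by rewrite perm_cons.
  by rewrite big_cons mulrCA mulrC mulrA.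
- have /(IH _ _ sP') : \prod_(j <- s) j * f = g * c.
    by apply: (mulfI p0); rewrite e mulrA mulrC.
  move=> [s1 [s2 [g' [h' [sE -> -> ->]]]]].
  exists s1, (p :: s2), g', h'; split=> //=.
    by rewrite -cat1s perm_catCA /= perm_cons.
  by rewrite big_cons mulrCA mulrC mulrA.
Qed.

Lemma divides_polyC (D : idomainType) (p : D) (f : {poly D}) :
  divides p%:P f -> divides p (lead_coef f).
Proof.
by case=> c ->; exists (lead_coef c); rewrite lead_coefM lead_coefC.
Qed.

(** Gauss's lemma, by induction on the sum of the sizes: p divides one of the two leading
    coefficients, and removing that leading term leaves a shorter polynomial. *)
Lemma prime_polyC (D : idomainType) (p : D) : prime_elt p -> prime_elt p%:P.
Proof.
case=> p0 pU pP; split; rewrite ?polyC_eq0 //.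
  by rewrite poly_unitE coefC /= negb_and pU orbT.
move=> f g; move: {2}(_ + _)%N (leqnn (size f + size g)) => k.
elim: k f g => [|k IH] f g.
  rewrite leqn0 addn_eq0 !size_poly_eq0 => /andP[/eqP-> _] _.
  by left; exists 0; rewrite mul0r.
have half (f' g' : {poly D}) : (size f' + size g' <= k.+1)%N ->
    divides p%:P (f' * g') -> divides p (lead_coef f') ->
    divides p%:P f' \/ divides p%:P g'.
  move=> le dfg [c ec].
  have [f0|f0] := eqVneq f' 0; first by left; exists 0; rewrite f0 mul0r.
  pose f1 := f' - lead_coef f' *: 'X^((size f').-1).
  have d1 : divides p%:P (lead_coef f' *: 'X^((size f').-1)).
    exists (c *: 'X^((size f').-1)).
    by rewrite ec [RHS]mulrC mul_polyC scalerA mulrC.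
  have ef : f' = f1 + lead_coef f' *: 'X^((size f').-1) by rewrite subrK.
  have lt : (size f1 < size f')%N.
    rewrite -[in ltnRHS](prednK (n := size f')) ?size_poly_gt0 // ltnS.
    apply/leq_sizeP => j; rewrite leq_eqVlt => /orP[/eqP <-|lj].
      by rewrite coefB coefZ coefXn eqxx mulr1 subrr.
    rewrite coefB coefZ coefXn (gtn_eqF lj) mulr0 subr0 nth_default //.
    by rewrite -[leqLHS](prednK (n := size f')) ?size_poly_gt0.
  have : divides p%:P f1 \/ divides p%:P g'.
    apply: IH; first by rewrite -ltnS (leq_trans _ le) // ltn_add2r.
    apply: (@dividesB _ _ _ (lead_coef f' *: 'X^((size f').-1) * g')).
      by rewrite -mulrDl -ef.
    exact: dividesMr.
  by case=> H; [left; rewrite ef; apply: dividesD | right].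
move=> le d; have := divides_polyC d; rewrite lead_coefM => /pP[].
  exact: half.
move=> dg; have := half g f; rewrite addnC mulrC => /(_ le d dg).
by case; [right|left].
Qed.

(** Dividing f by a constant prime uses up at least one of the finitely many prime factors of the
    leading coefficient, so the extraction stops. *)
Lemma primitive_part (D : idomainType) (f : {poly D}) :
  factorial_dom D -> f != 0 -> exists c f0,
    [/\ c != 0, f = c%:P * f0 & forall p, prime_elt p -> ~ divides p%:P f0].
Proof.
move=> fD f0; have := f0; rewrite -lead_coef_eq0 => /fD [u [s [uU sP e]]].
move: {2}(size s) (erefl (size s)) => k.
elim/ltn_ind: k f f0 u s uU sP e => k IH f f0 u s uU sP e szs.
case: (classic (forall p, prime_elt p -> ~ divides p%:P f)) => [H|nH].
  by exists 1, f; rewrite oner_eq0 mul1r.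
have [p np] := not_all_ex_not _ _ nH.
have [pP /NNPP dp] := imply_to_and _ _ np; have [f1 ef] := dp.
have [p0 pU _] := pP.
have [|s1 [s2 [g' [h' [sE e1 e2 eu]]]]] :=
    @split_prime_factors _ s u p (lead_coef f1) sP.
  by rewrite mulrC -e ef lead_coefM lead_coefC mulrC.
move: uU; rewrite eu unitrM => /andP[gU hU].
case: s1 => [|q s1] in sE e1; first by rewrite e1 big_nil mulr1 gU in pU.
have f10 : f1 != 0 by apply: contraNneq f0 => h; rewrite ef h mul0r.
have [||c [f2 [c0 ef2 H]]] := IH (size s2) _ f1 f10 h' s2 hU _ e2 (erefl _).
- by rewrite -szs -(perm_size sE) size_cat /= addSn ltnS leq_addl.
- by move=> r rs; apply: sP; rewrite -(perm_mem sE) mem_cat rs orbT.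
exists (p * c), f2; split=> //; first by rewrite mulf_neq0.
by rewrite ef ef2 mulrC polyCM mulrA.
Qed.

(** Here [%|] is divisibility up to nonzero constants, that is, over the fraction field. There f is
    irreducible and Euclid's lemma applies; primitivity of f brings the quotient back to D[X]. *)
Lemma prime_polyE (D : idomainType) (f : {poly D}) :
  factorial_dom D -> (1 < size f)%N ->
  (forall p, prime_elt p -> ~ divides p%:P f) ->
  (forall g h, f = g * h -> (size g <= 1)%N \/ (size h <= 1)%N) ->
  prime_elt f.
Proof.
move=> fD szf prf irf.
have f0 : f != 0 by rewrite -size_poly_gt0 ltnW.
(* The primes of [c] are cancelled against [g] or [h]; [c2] collects those taken from [h], so it is
   a unit when [h] is primitive. *)
have clear (c : D) x g h : c != 0 -> c *: x = g * h -> exists c1 c2 g' h',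
   [/\ c2 != 0, g = g' * c1%:P, h = h' * c2%:P,
       divides c2%:P h & x = g' * h' /\
       (c2 \is a GRing.unit \/ exists2 p, prime_elt p & divides p%:P h)].
  move=> c0 e; have [u [s [uU sP ec]]] := fD _ c0.
  have := @split_prime_factors _ (map polyC s) x (u^-1 *: g) h.
  case=> [_ /mapP[p ps ->]||s1 [s2 [g' [h' [sE e1 e2 ex]]]]].
  - exact/prime_polyC/sP.
  - by rewrite -scalerAl -e ec scalerA mulKr // -mul_polyC rmorph_prod big_map.
  have sub t : {subset t <= map polyC s} -> exists2 t', t = map polyC t' & {subset t' <= s}.
    elim: t => [|y t IHt]; first by exists [::].
    move=> H; have /mapP[x' xs ->] := H y (mem_head _ _).
    have [|t' -> H'] := IHt; first by move=> z zt; apply: H; rewrite inE zt orbT.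
    by exists (x' :: t') => // z; rewrite inE => /orP[/eqP->|/H'].
  have [|t1 et1 _] := sub s1.
    by move=> z zs; rewrite -(perm_mem sE) mem_cat zs.
  have [|t2 et2 ts2] := sub s2.
    by move=> z zs; rewrite -(perm_mem sE) mem_cat zs orbT.
  have prodE t : \prod_(p <- map polyC t) p = (\prod_(p <- t) p)%:P.
    by rewrite rmorph_prod big_map.
  rewrite et1 prodE in e1; rewrite et2 prodE in e2.
  exists (u * \prod_(p <- t1) p), (\prod_(p <- t2) p), g', h'; split=> //.
  - by rewrite prodf_seq_neq0; apply/allP => p /ts2 /sP [].
  - by rewrite polyCM mulrCA -e1 mul_polyC scalerA mulrV ?scale1r.
  - by exists h'.
  split=> //; case: t2 ts2 e2 {et2} => [|p t2] ts2 e2; first by left; rewrite big_nil unitr1.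
  right; exists p; first by apply/sP/ts2/mem_head.
  by rewrite e2 big_cons polyCM mulrCA; apply: dividesMr; exists 1; rewrite mul1r.
have prim g : f %| g -> divides f g.
  case/Pdiv.Idomain.dvdpP => -[c r] /= c0 /(clear _ _ _ _ c0).
  case=> c1 [c2 [g' [h' [c20 eg eh _ [ex H]]]]].
  case: H => [cU|[p pP /(prf _ pP)] //].
  exists (c2^-1 *: g'); rewrite ex eh -scalerAl mulrA [_ * c2%:P]mulrC.
  by rewrite mul_polyC scalerA mulVr ?scale1r.
have irr : irreducible_poly f.
  split=> // q q1 /[dup] dq /Pdiv.Idomain.dvdpP => -[[c r] /= c0].
  have q0 : q != 0 by apply: contraNneq f0 => h; rewrite h dvd0p in dq.
  move=> /(clear _ _ _ _ c0) [c1 [c2 [g' [h' [c20 eg eh _ [ex _]]]]]].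
  have szq : size q = size h' by rewrite eh mulrC size_Cmul.
  rewrite -dvdp_size_eqp // szq ex.
  have sz1 : (1 < size q)%N.
    by move: q1 q0; rewrite -size_poly_gt0; case: (size q) => [|[|]].
  case: (irf _ _ ex) => [sg|]; last by rewrite -szq leqNgt sz1.
  have g0 : g' != 0 by apply: contraNneq f0 => h; rewrite ex h mul0r.
  rewrite (size1_polyC sg) size_Cmul //.
  by rewrite -polyC_eq0 -(size1_polyC sg).
split=> //; first by rewrite poly_unitE (gtn_eqF szf).
move=> a b [c ec].
have dab : f %| a * b by rewrite ec dvdp_mull.
have [fa|nfa] := boolP (f %| a); first by left; exact: prim.
right; apply: prim; rewrite -(@Gauss_dvdpr _ b a) //.
by rewrite (irreducible_poly_coprime _ irr).
Qed.

(** Induction on the size: either f splits into two nonconstant factors, both shorter, or its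
    primitive part is prime and its content factors in D. *)
Lemma factorial_poly (D : idomainType) : factorial_dom D -> factorial_dom {poly D}.
Proof.
move=> fD f; move: {2}(size f) (leqnn (size f)) => k; elim: k f => [|k IH] f.
  by rewrite leqn0 size_poly_eq0 => /eqP->; rewrite eqxx.
have Cfact (c : D) : c != 0 -> prime_product c%:P.
  move=> /fD [u [s [uU sP ->]]]; exists u%:P, (map polyC s); split.
  - by rewrite poly_unitE coefC /= uU size_polyC (_ : u != 0) //; apply: contraTneq uU => ->; rewrite unitr0.
  - by move=> _ /mapP[p /sP /prime_polyC pP ->].
  - by rewrite big_map polyCM rmorph_prod.
move=> le f0; have [sz1|sz1] := leqP (size f) 1.
  rewrite (size1_polyC sz1); apply: Cfact.
  by rewrite -polyC_eq0 -(size1_polyC sz1).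
have [[g [h [ef sg sh]]]|H] := classic (exists g h,
   [/\ f = g * h, (1 < size g)%N & (1 < size h)%N]).
  have g0 : g != 0 by rewrite -size_poly_gt0 ltnW.
  have h0 : h != 0 by rewrite -size_poly_gt0 ltnW.
  move: le; rewrite ef size_mul //; move: (size g) (size h) sg sh (IH g) (IH h).
  move=> [|[|a]] [|[|b]] // _ _ IHg IHh le; apply: prime_productM.
    by apply: IHg => //; move: le; rewrite !addnS /= !addSn ltnS; apply: leq_trans; rewrite !ltnS leq_addr.
  by apply: IHh => //; move: le; rewrite !addnS /= !addSn ltnS; apply: leq_trans; rewrite !ltnS leq_addl.
have [c [f1 [c0 ef prf]]] := primitive_part fD f0.
rewrite ef; apply: prime_productM; first exact: Cfact.
exists 1, [:: f1]; rewrite unitr1 big_seq1 mul1r; split=> // p; rewrite inE => /eqP->.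
have szf1 : size f = size f1 by rewrite ef size_Cmul.
apply: prime_polyE => //; first by rewrite -szf1.
move=> g h e; have [|sg] := leqP (size g) 1; [by left|right].
rewrite leqNgt; apply/negP => sh; apply: H; exists (c%:P * g), h.
by rewrite -mulrA -e size_Cmul.
Qed.

Lemma factorial_iso (D E : idomainType) (g : {rmorphism D -> E}) :
  bijective g -> factorial_dom E -> factorial_dom D.
Proof.
case=> f gK fK fE x x0.
have fM a b : f (a * b) = f a * f b by apply: (can_inj gK); rewrite rmorphM !fK.
have f1 : f 1 = 1 by apply: (can_inj gK); rewrite rmorph1 fK.
have f0 : f 0 = 0 by apply: (can_inj gK); rewrite rmorph0 fK.
have fU u : u \is a GRing.unit -> f u \is a GRing.unit.
  by move=> uU; apply/unitrP; exists (f u^-1); rewrite -!fM mulVr ?mulrV.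
have [|u [s [uU sP e]]] := fE (g x).
  by apply: contraNneq x0 => h; rewrite -(gK x) h f0.
exists (f u), (map f s); split; first exact: fU.
- move=> _ /mapP[p /sP [p0 pU pP] ->]; split.
  + by apply: contraNneq p0 => h; rewrite -(fK p) h rmorph0.
  + by apply: contraNN pU => /(rmorph_unit g); rewrite fK.
  move=> a b [c ec]; have : divides p (g a * g b).
    by exists (g c); rewrite -rmorphM ec rmorphM fK.
  by case/pP=> -[d ed]; [left|right]; exists (f d); rewrite -fM -ed gK.
- rewrite -[x]gK e fM big_map (big_morph f fM f1) //.
Qed.

Lemma unit_intE (x : int) : (x \is a GRing.unit) = (x == 1) || (x == -1).
Proof. by []. Qed.

Lemma factorial_int : factorial_dom int.
Proof.
move=> x x0.
have : exists s, (forall p : int, p \in s -> prime_elt p) /\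
    (`|x|%N : int) = \prod_(p <- s) p.
  move: (x0); rewrite -absz_gt0; move: `|x|%N => k.
  elim/ltn_ind: k => -[|[|k]] IH k0.
  - by rewrite ltnn in k0.
  - by exists [::]; rewrite big_nil.
  set q := pdiv k.+2; have qP : prime q by rewrite pdiv_prime.
  have /dvdnP[l el] := pdiv_dvd k.+2.
  have l0 : (0 < l)%N by case: l el.
  have [|s [sP es]] := IH l _ l0.
    by rewrite el -[ltnLHS]muln1 ltn_pmul2l // prime_gt1.
  exists (q%:Z :: s); split; last by rewrite big_cons -es el PoszM mulrC.
  move=> p; rewrite inE => /orP[/eqP->|/sP//]; split.
  - by rewrite eqz_nat -lt0n prime_gt0.
  - by rewrite unit_intE; case: q qP {el} => [|[|]].
  move=> a b [c ec]; have : (q %| absz (a * b)%R)%N by rewrite ec abszM dvdn_mull.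
  rewrite abszM Euclid_dvdM // => /orP[] /dvdnP[d ed]; [left|right].
    by exists (sgz a * d); rewrite -mulrA -PoszM -ed; apply: intEsg.
  by exists (sgz b * d); rewrite -mulrA -PoszM -ed; apply: intEsg.
case=> s [sP es]; exists (sgz x), s; split=> //.
  by rewrite unit_intE; case: sgzP x0.
by rewrite -es; apply: intEsg.
Qed.

Lemma factorial_mpoly n : factorial_dom {mpoly int[n]}.
Proof.
elim: n => [|n IH].
  have bij : bijective (mcoeff (0%MM : 'X_{1..0}) : {rmorphism {mpoly int[0]} -> int}).
    exists (mpolyC 0 (R := int)); last exact: mpolyCK.
    move=> p; apply/mpolyP => m; rewrite mcoeffC.
    have -> : m = 0%MM by apply/mnmP; case.
    by rewrite eqxx mulr1.
  exact: (factorial_iso bij factorial_int).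
(* The inverse of [muni]: widen the coefficients and substitute the last variable. *)
pose f (p : {poly {mpoly int[n]}}) := (map_poly (@mwiden n int) p).['X_ord_max].
have fM : {morph f : p q / p * q}.
  by move=> p q; rewrite /f rmorphM hornerM.
have fD : {morph f : p q / p + q}.
  by move=> p q; rewrite /f rmorphD hornerD.
have f0 : f 0 = 0 by rewrite /f rmorph0 horner0.
have fC c : f c%:P = mwiden c by rewrite /f map_polyC hornerC.
have fX k : f 'X^k = 'X_ord_max ^+ k by rewrite /f map_polyXn hornerXn.
have muX : muni ('X_ord_max : {mpoly int[n.+1]}) = 'X.
  rewrite /muni mmapX mmap1U; case: splitP => //= j ej.
  by move: (ltn_ord j); rewrite -ej ltnn.
have muXw i : muni ('X_(widen_ord (leqnSn n) i) : {mpoly int[n.+1]}) = ('X_i)%:P.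
  rewrite /muni mmapX mmap1U; case: splitP => /= j ej.
    by congr ('X__)%:P; apply/val_inj.
  by move: (ltn_ord i); rewrite ej ord1 addn0 ltnn.
have muw c : muni (mwiden c : {mpoly int[n.+1]}) = c%:P.
  elim/mpolyind: c => [|c m p _ _ IHp]; first by rewrite !raddf0.
  rewrite mwidenD mwidenZ !raddfD /= IHp; congr (_ + _).
  rewrite muniZ mpolyXE_id !rmorph_prod /= -mul_polyC -mul_mpolyC polyCM rmorph_prod.
  congr (_ * _); apply: eq_bigr => i _.
  by rewrite !rmorphXn /= mwidenX mnmwiden1 muXw.
apply: (factorial_iso (g := @muni n int)) (factorial_poly IH).
exists f => p.
  rewrite /= muniE (big_morph f fD f0) [RHS]mpolyE; apply: eq_bigr => m _.
  rewrite -mul_polyC fM fC fX mwidenZ mwidenX -scalerAl mpolyXn -mpolyXD.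
  congr (_ *: 'X_[_]); apply/mnmP => i; rewrite mnmDE mulmnE mnm1E.
  have [j ->|->] := unliftP ord_max i.
    have -> : lift ord_max j = widen_ord (leqnSn n) j.
      by apply: val_inj; rewrite /= /bump leqNgt ltn_ord.
    rewrite mnmwiden_widen mnmE -val_eqE /= (gtn_eqF (ltn_ord j)) mul0n addn0 //.
  by rewrite mnmwiden_ordmax eqxx mul1n.
elim/poly_ind: p => [|p c IHp]; first by rewrite f0 rmorph0.
have fX1 : f 'X = 'X_ord_max by rewrite /f map_polyX hornerX.
by rewrite fD fM fX1 fC rmorphD rmorphM /= [X in X * _]IHp muX muw.
Qed.

(** * Determinants up to sign *)

Definition eqpm (V : zmodType) (a b : V) := a = b \/ a = - b.

Lemma eqpm_sym (V : zmodType) (a b : V) : eqpm a b -> eqpm b a.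
Proof. by case=> ->; [left|right; rewrite opprK]. Qed.

Lemma eqpm_trans (V : zmodType) (a b c : V) : eqpm a b -> eqpm b c -> eqpm a c.
Proof.
by case=> -> [->|->]; rewrite ?opprK; [left|right|right|left].
Qed.

Lemma eqpmM (A : comNzRingType) (a b c d : A) :
  eqpm a b -> eqpm c d -> eqpm (a * c) (b * d).
Proof.
by case=> -> [->|->]; rewrite ?mulrN ?mulNr ?opprK; [left|right|right|left].
Qed.

Lemma eqpmX (A : comNzRingType) (a b : A) k : eqpm a b -> eqpm (a ^+ k) (b ^+ k).
Proof.
move=> ab; elim: k => [|k IH]; first by left.
by rewrite !exprS; apply: eqpmM.
Qed.

Lemma eqpm_map (A B : pzRingType) (th : {rmorphism A -> B}) (a b : A) :
  eqpm a b -> eqpm (th a) (th b).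
Proof. by case=> ->; rewrite ?rmorphN; [left|right]. Qed.

Lemma eqpm_sign (A : comNzRingType) (b : bool) (a : A) : eqpm ((-1) ^+ b * a) a.
Proof. by case: b; rewrite ?mul1r ?mulN1r; [right|left]. Qed.

(* [d] is, up to sign, the determinant of the square matrix with entries
   [M i j]; its sign is undefined since rows and columns are not ordered. *)
Definition isdet (A : comNzRingType) (I J : finType) (M : I -> J -> A) (d : A) :=
  exists k (e : 'I_k -> I) (f : 'I_k -> J),
    [/\ bijective e, bijective f & eqpm d (\det (\matrix_(i, j) M (e i) (f j)))].

Section IsDet.
Variable A : comNzRingType.
Implicit Types I J K : finType.

Lemma bij_ord_card I k (e : 'I_k -> I) : bijective e -> k = #|I|.
Proof. by move/bij_eq_card; rewrite card_ord. Qed.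

(** Two orderings differ by a permutation, whose sign [eqpm] absorbs. This also makes the final
    theorem independent of the orders of the bases. *)
Lemma isdetE I J (M : I -> J -> A) d k (e : 'I_k -> I) (f : 'I_k -> J) :
  isdet M d -> bijective e -> bijective f ->
  eqpm d (\det (\matrix_(i, j) M (e i) (f j))).
Proof.
move=> [k' [e' [f' [be' bf' h]]]] be bf; apply: eqpm_trans h _.
have ek : k' = k by rewrite (bij_ord_card be') (bij_ord_card be).
subst k'; case: be bf => [ei eiK eKi] [fi fiK fKi].
have inj_e : injective (ei \o e').
  by apply: inj_comp (bij_inj be'); apply: (can_inj eKi).
have inj_f : injective (fi \o f').
  by apply: inj_comp (bij_inj bf'); apply: (can_inj fKi).
set N := \matrix_(i, j) M (e i) (f j).
have -> : \matrix_(i, j) M (e' i) (f' j) =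
    row_perm (perm inj_e) (col_perm (perm inj_f) N).
  by apply/matrixP => i j; rewrite !mxE !permE /= eKi fKi.
rewrite row_permE col_permE !det_mulmx !det_perm.
by apply: eqpm_trans (eqpm_sign _ _) _; rewrite mulrC; apply: eqpm_sign.
Qed.

Lemma isdet_uniq I J (M : I -> J -> A) d d' :
  isdet M d -> isdet M d' -> eqpm d d'.
Proof.
move=> h [k [e [f [be bf h']]]].
exact: eqpm_trans (isdetE h be bf) (eqpm_sym h').
Qed.

Lemma isdet_eqpm I J (M : I -> J -> A) d d' : isdet M d -> eqpm d' d -> isdet M d'.
Proof.
move=> [k [e [f [be bf h]]]] h'; exists k, e, f; split=> //.
exact: eqpm_trans h' h.
Qed.

Lemma eq_isdet I J (M N : I -> J -> A) d : M =2 N -> isdet M d -> isdet N d.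
Proof.
move=> MN [k [e [f [be bf h]]]]; exists k, e, f; split=> //.
suff -> : \matrix_(i, j) N (e i) (f j) = \matrix_(i, j) M (e i) (f j) by [].
by apply/matrixP => i j; rewrite !mxE MN.
Qed.

Lemma isdet_exists I J (M : I -> J -> A) : #|I| = #|J| -> exists d, isdet M d.
Proof.
move=> c; pose e (i : 'I_#|I|) := enum_val i.
pose f (i : 'I_#|I|) : J := enum_val (cast_ord c i).
exists (\det (\matrix_(i, j) M (e i) (f j))), #|I|, e, f; split; last by left.
  exact: enum_val_bij.
apply: bij_comp; first exact: enum_val_bij.
by exists (cast_ord (esym c)) => x; rewrite ?cast_ordK ?cast_ordKV.
Qed.

Lemma isdet_reindex I J I' J' (g : I' -> I) (h : J' -> J) (M : I -> J -> A) d :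
  bijective g -> bijective h -> isdet M d -> isdet (fun i j => M (g i) (h j)) d.
Proof.
move=> [gi gK Kg] [hi hK Kh] [k [e [f [be bf H]]]].
exists k, (gi \o e), (hi \o f); split.
- by apply: bij_comp => //; exists g.
- by apply: bij_comp => //; exists h.
suff -> : \matrix_(i, j) M (g ((gi \o e) i)) (h ((hi \o f) j)) =
          \matrix_(i, j) M (e i) (f j) by [].
by apply/matrixP => i j; rewrite !mxE /= Kg Kh.
Qed.

Lemma isdet_mul I J K (M : I -> J -> A) (N : J -> K -> A) d d' :
  isdet M d -> isdet N d' -> isdet (fun i k => \sum_j M i j * N j k) (d * d').
Proof.
move=> [k [e [f [be bf h]]]] hN; have [k' [e' [f' [be' bf' _]]]] := hN.
have ek : k' = k by rewrite (bij_ord_card be') (bij_ord_card bf).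
subst k'; exists k, e, f'; split=> //.
have h' := isdetE hN bf bf'.
apply: eqpm_trans (eqpmM h h') _; rewrite -det_mulmx; left; congr (\det _).
apply/matrixP => i j; rewrite !mxE (reindex f) /=; last exact: onW_bij.
by apply: eq_bigr => l _; rewrite !mxE.
Qed.

(** When bijective, it encodes a splitting of the index set [I] into two blocks, with no order
    involved. *)
Definition sum_case I1 I2 I (g1 : I1 -> I) (g2 : I2 -> I) (x : I1 + I2) :=
  match x with inl a => g1 a | inr b => g2 b end.

Lemma sum_case_bij I1 I2 I (g1 : I1 -> I) (g2 : I2 -> I) :
  injective g1 -> injective g2 -> (forall a b, g1 a <> g2 b) ->
  (#|I| <= #|I1| + #|I2|)%N -> bijective (sum_case g1 g2).
Proof.
move=> i1 i2 d c; apply: inj_card_bij; last by rewrite card_sum.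
move=> [a|a] [b|b] /= h.
- by rewrite (i1 _ _ h).
- by case: (d _ _ h).
- by case: (d _ _ (esym h)).
- by rewrite (i2 _ _ h).
Qed.

Lemma isdet_block I1 I2 I J1 J2 J (g1 : I1 -> I) (g2 : I2 -> I)
    (h1 : J1 -> J) (h2 : J2 -> J) (M : I -> J -> A) d1 d2 :
  bijective (sum_case g1 g2) -> bijective (sum_case h1 h2) ->
  (forall i j, M (g1 i) (h2 j) = 0) ->
  isdet (fun i j => M (g1 i) (h1 j)) d1 ->
  isdet (fun i j => M (g2 i) (h2 j)) d2 -> isdet M (d1 * d2).
Proof.
move=> bg bh M0 [k1 [e1 [f1 [be1 bf1 H1]]]] [k2 [e2 [f2 [be2 bf2 H2]]]].
have bs (P1 P2 P : finType) (q1 : P1 -> P) (q2 : P2 -> P)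
    (e : 'I_k1 -> P1) (f : 'I_k2 -> P2) : bijective (sum_case q1 q2) ->
    bijective e -> bijective f ->
    bijective (fun i => sum_case (q1 \o e) (q2 \o f) (split i)).
  move=> bq [ei eK Ke] [fi fK Kf].
  have b1 : bijective (@split k1 k2).
    by exists unsplit; [exact: splitK|exact: unsplitK].
  apply: (@bij_comp _ _ _ (sum_case (q1 \o e) (q2 \o f)) (@split k1 k2)) => //.
  apply: (@eq_bij _ _ (sum_case q1 q2 \o
     (fun x => match x with inl a => inl (e a) | inr b => inr (f b) end))).
    apply: bij_comp => //.
    exists (fun x => match x with inl a => inl (ei a) | inr b => inr (fi b) end).
      by case=> x /=; rewrite ?eK ?fK.
    by case=> x /=; rewrite ?Ke ?Kf.
  by case.
exists (k1 + k2)%N, (fun i => sum_case (g1 \o e1) (g2 \o e2) (split i)),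
   (fun i => sum_case (h1 \o f1) (h2 \o f2) (split i)).
split; [exact: bs|exact: bs|].
apply: eqpm_trans (eqpmM H1 H2) _; left.
rewrite -(det_lblock _ (\matrix_(i, j) M (g2 (e2 i)) (h1 (f1 j)))); congr (\det _).
apply/matrixP => i j; rewrite !mxE.
by case: (split i) => a; rewrite !mxE; case: (split j) => b; rewrite !mxE //= M0.
Qed.

Lemma isdet1 I : isdet (fun i j : I => (i == j)%:R : A) 1.
Proof.
exists #|I|, enum_val, enum_val; split; try exact: enum_val_bij.
left; rewrite -[LHS](det1 A #|I|); congr (\det _); apply/matrixP => i j.
by rewrite !mxE (inj_eq enum_val_inj).
Qed.

Lemma isdet_map (B : comNzRingType) (th : {rmorphism A -> B}) I J
    (M : I -> J -> A) d : isdet M d -> isdet (fun i j => th (M i j)) (th d).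
Proof.
move=> [k [e [f [be bf h]]]]; exists k, e, f; split=> //.
have -> : \matrix_(i, j) th (M (e i) (f j)) =
     map_mx th (\matrix_(i, j) M (e i) (f j)) by apply/matrixP => i j; rewrite !mxE.
by rewrite det_map_mx; case: h => ->; rewrite ?rmorphN; [left|right].
Qed.

(** The adjugate of N, up to sign, is an inverse of determinant +-1; multiplying by it turns M + N X
    into the characteristic matrix of - N^-1 M. *)
Lemma isdet_pencil I J (M N : I -> J -> A) d :
  isdet N 1 -> isdet (fun i j => (M i j)%:P + N i j *: 'X) d ->
  exists2 q, eqpm d q & q \is monic.
Proof.
move=> hN [k [e [f [be bf h]]]]; have {}hN := isdetE hN be bf.
set P := (\matrix_(i, j) N (e i) (f j)) in hN.
set Q := (\matrix_(i, j) M (e i) (f j)).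
have [Pi PiP detPi] : exists2 Pi, Pi *m P = 1%:M & eqpm (\det Pi) 1.
  case: hN => h1.
    exists (\adj P); first by rewrite mul_adj_mx -h1.
    have := congr1 determinant (mul_adj_mx P).
    by rewrite -h1 det1 det_mulmx -h1 mulr1 => ->; left.
  have h1' : \det P = -1 by rewrite h1 opprK.
  exists (- \adj P); first by rewrite mulNmx mul_adj_mx h1' raddfN opprK.
  have := congr1 determinant (etrans (mulNmx (\adj P) P) (congr1 -%R (mul_adj_mx P))).
  rewrite det_mulmx h1' mulrN1 raddfN opprK det1 => h2.
  by right; rewrite -h2 opprK.
exists (char_poly (- (Pi *m Q))); last exact: char_poly_monic.
apply: eqpm_trans h _.
have -> : char_poly (- (Pi *m Q)) =
   \det (map_mx polyC Pi *m (\matrix_(i, j) ((M (e i) (f j))%:P + N (e i) (f j) *: 'X))).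
  rewrite /char_poly /char_poly_mx; congr (\det _).
  have -> : (\matrix_(i, j) ((M (e i) (f j))%:P + N (e i) (f j) *: 'X)) =
      map_mx polyC Q + 'X *: map_mx polyC P.
    apply/matrixP => i j; rewrite !mxE; congr (_ + _).
    by rewrite -mul_polyC mulrC.
  rewrite mulmxDr -scalemxAr -!map_mxM PiP map_mx1 map_mxN opprK addrC.
  by rewrite scalemx1.
rewrite det_mulmx det_map_mx; apply: eqpm_sym.
case: detPi => ->; rewrite ?rmorphN rmorph1 ?mulN1r ?mul1r; [left|right] => //.
Qed.

End IsDet.

Lemma isdet0_kernel (F : fieldType) (I J : finType) (M : I -> J -> F) :
  isdet M 0 -> exists2 x : J -> F, (exists j, x j != 0) &
    forall i, \sum_j M i j * x j = 0.
Proof.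
move=> [k [e [f [be [fi fK Kf] h]]]].
have d0 : \det (\matrix_(i, j) M (e i) (f j))^T == 0.
  by rewrite det_tr; case: h => h; [rewrite -h | rewrite -oppr_eq0 -h].
have /det0P[v v0 vM] := d0.
exists (fun j => v 0 (fi j)).
  have /rV0Pn[j vj] := v0; exists (f j); by rewrite fK.
case: be => ei eK Ke i; rewrite (reindex f) /=; last by apply: onW_bij; exists fi.
have := congr1 (fun w : 'rV_k => w 0 (ei i)) vM; rewrite !mxE => h'.
by rewrite -[RHS]h'; apply: eq_bigr => j _; rewrite !mxE fK Ke mulrC.
Qed.

Lemma isdet_left_kernel (F : fieldType) (I J : finType) (M : I -> J -> F) d
    (x : I -> F) i0 : isdet M d -> x i0 != 0 ->
    (forall j, \sum_i x i * M i j = 0) -> d = 0.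
Proof.
move=> [k [e [f [be [fi fK Kf] h]]]] x0 xM.
have /eqP d0 : \det (\matrix_(i, j) M (e i) (f j)) == 0.
  apply/det0P; exists (\row_i x (e i)).
    case: be => ei eK Ke; apply/rV0Pn; exists (ei i0); by rewrite mxE Ke.
  apply/rowP => j; rewrite !mxE -[RHS](xM (f j)) [RHS](reindex e) /=; last exact: onW_bij.
  by apply: eq_bigr => i _; rewrite !mxE.
by case: h => ->; rewrite d0 ?oppr0.
Qed.

Lemma isdet_size (R : comNzRingType) (I J : finType) (M : I -> J -> {poly R}) d
    (w : J -> nat) : isdet M d -> (forall i j, size (M i j) <= (w j).+1)%N ->
  (size d <= (\sum_j w j).+1)%N.
Proof.
move=> [k [e [f [be bf h]]]] sM.
have -> : size d = size (\det (\matrix_(i, j) M (e i) (f j))).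
  by case: h => ->; rewrite ?size_polyN.
rewrite /determinant; apply: leq_trans (size_sum _ _ _) _.
apply/bigmax_leqP => s _; set p := \prod_i _.
have -> : size ((-1) ^+ s * p) = size p.
  by case: (odd_perm s); rewrite ?mulN1r ?size_polyN ?mul1r.
have -> : (\sum_j w j = \sum_(i < k) w (f (s i)))%N.
  rewrite (reindex f) /=; last exact: onW_bij.
  by rewrite (reindex_inj (@perm_inj _ s)).
rewrite {}/p; elim/big_ind2: _.
- by rewrite size_poly1.
- move=> q1 a1 q2 a2 l1 l2; apply: leq_trans (size_polyMleq _ _) _.
  by rewrite -subn1 leq_subLR add1n -addnS -addSn leq_add.
- by move=> i _; rewrite mxE.
Qed.

(** * Syzygies of three univariate polynomials *)

Definition next3 (i : 'I_3) : 'I_3 := ordS i.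

Lemma next3K i : next3 (next3 (next3 i)) = i.
Proof. by apply: val_inj; case: i => [[|[|[|//]]] ?]. Qed.

Lemma sum3 (V : nmodType) (F : 'I_3 -> V) i :
  \sum_j F j = F i + F (next3 i) + F (next3 (next3 i)).
Proof.
pose G k := F (inord k); have FE j : F j = G j by rewrite /G inord_val.
rewrite (eq_bigr (fun j : 'I_3 => G j)) => [|j _]; last exact: FE.
rewrite !big_ord_recr big_ord0 /= add0r !FE /=.
case: i => [[|[|[|//]]] hi] /=; rewrite ?modnn //.
  by rewrite [RHS]addrC addrA.
by rewrite -[RHS]addrA [RHS]addrC.
Qed.

(** The cross product in R^3 with cyclic indices; [cross v w] is a Koszul syzygy of [w]. *)
Definition cross (R : pzRingType) (v w : 'I_3 -> R) (i : 'I_3) : R :=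
  v (next3 i) * w (next3 (next3 i)) - v (next3 (next3 i)) * w (next3 i).

Section Cross.
Variable R : comNzRingType.
Implicit Types v w b : 'I_3 -> R.

Lemma cross_dot v w : \sum_i cross v w i * w i = 0.
Proof. by rewrite (sum3 _ ord0) /cross !next3K; ring. Qed.

Lemma cross_crossr v w b i :
  cross v (cross w b) i = w i * (\sum_j b j * v j) - b i * (\sum_j w j * v j).
Proof. by rewrite !(sum3 _ i) /cross !next3K; ring. Qed.

Lemma cross_self v i : cross v v i = 0.
Proof. by rewrite /cross; ring. Qed.

Lemma crossDl v v' w i : cross (fun j => v j + v' j) w i = cross v w i + cross v' w i.
Proof. by rewrite /cross; ring. Qed.

Lemma crossZl a v w i : cross (fun j => a * v j) w i = a * cross v w i.
Proof. by rewrite /cross; ring. Qed.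

Lemma cross_shift a v w i : cross v (fun j => w j + a * v j) i = cross v w i.
Proof. by rewrite /cross; ring. Qed.

Lemma crossNl v w i : cross (fun j => - v j) w i = cross w v i.
Proof. by rewrite /cross; ring. Qed.

Lemma cross_suml (I : Type) (r : seq I) (v : I -> 'I_3 -> R) w i :
  cross (fun j => \sum_(k <- r) v k j) w i = \sum_(k <- r) cross (v k) w i.
Proof. by rewrite /cross !big_distrl -sumrB. Qed.

End Cross.

Section Univariate.
Variables (F : fieldType) (n : nat) (f b : 'I_3 -> {poly F}).
Hypothesis sf : forall i, (size (f i) <= n.+1)%N.
Hypothesis bf : \sum_i b i * f i = 1.
Variable i0 : 'I_3.
Hypothesis fn : (f i0)`_n != 0.

(** For k = 1, ..., n these form a basis of the syzygies of degree < n, by [cross_span] and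
    [cross_free]. The count agrees with 3n unknown coefficients and 2n equations. *)
Let del k i := cross (fun j => drop_poly k (f j)) f i.

(* As [drop_poly k f] is parallel to itself, [f] may be replaced by its remainder
   [take_poly k f] in the cross product. *)
Lemma size_cross_drop k i : (0 < k <= n)%N -> (size (del k i) <= n)%N.
Proof.
move=> /andP[k0 kn].
have -> : del k i = cross (fun j => drop_poly k (f j)) (fun j => take_poly k (f j)) i.
  rewrite /del -[RHS](cross_shift 'X^k).
  by rewrite /cross !(mulrC 'X^k) !poly_take_drop.
have sM (j l : 'I_3) : (size (drop_poly k (f j) * take_poly k (f l))%R <= n)%N.
  apply: leq_trans (size_polyMleq _ _) _; rewrite size_drop_poly.
  have := size_take_poly k (f l); have := sf j.
  by move: (size (f j)) (size (take_poly k (f l))) kn k0; lia.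
by rewrite /cross; apply: leq_trans (size_polyD _ _) _; rewrite size_polyN geq_max !sM.
Qed.

(* The top coefficient of [h] is parallel to that of [f], so subtracting a
   multiple of ['X^(d - n) * f] or of [drop_poly (n - d) f] lowers the degree. *)
Lemma cross_span_bounded (h : 'I_3 -> {poly F}) d :
  (forall i, (size (h i) <= d)%N) -> (forall i, (size (cross h f i) <= n)%N) ->
  exists la : 'I_n -> F, forall i, cross h f i = \sum_a la a *: del a.+1 i.
Proof.
elim: d h => [|d IH] h sh sc.
  exists (fun _ => 0) => i; rewrite big1 => [|a _]; last by rewrite scale0r.
  have h0 j : h j = 0 by apply/eqP; rewrite -size_poly_leq0.
  by rewrite /cross !h0; ring.
have coefM' j l : (h j * f l)`_(d + n) = (h j)`_d * (f l)`_n.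
  rewrite coefM (bigD1 (inord d)) //= big1 => [|q qd].
    by rewrite inordK ?ltnS ?leq_addr // addr0 addKn.
  have [lt|le] := ltnP q d.
    rewrite [(f l)`__]nth_default ?mulr0 //; apply: leq_trans (sf l) _.
    by move: lt; lia.
  rewrite [(h j)`__]nth_default ?mul0r //; apply: leq_trans (sh j) _.
  rewrite ltn_neqAle le andbT; apply: contraNneq qd => e; apply/eqP/val_inj.
  by rewrite /= inordK ?ltnS ?leq_addr.
(* Coefficient d + n of [cross h f] vanishes because its size is at most n. *)
have par i : (h i)`_d * (f (next3 i))`_n = (h (next3 i))`_d * (f i)`_n.
  have : (cross h f (next3 (next3 i)))`_(d + n) = 0.
    by apply: nth_default; apply: leq_trans (sc _) _; apply: leq_addl.
  by rewrite /cross coefB !coefM' !next3K => /eqP; rewrite subr_eq0 => /eqP.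
pose ka := (h i0)`_d / (f i0)`_n.
have top i : (h i)`_d = ka * (f i)`_n.
  apply: (mulIf fn); rewrite /ka mulrAC divfK //.
  have : i \in [:: i0; next3 i0; next3 (next3 i0)].
    by rewrite !inE -!val_eqE; case: (i) (i0) => [[|[|[|//]]] ?] [[|[|[|//]]] ?].
  rewrite !inE => /or3P[] /eqP-> //.
  by have := par (next3 (next3 i0)); rewrite next3K.
pose r j := if (n <= d)%N then 'X^(d - n) * f j else drop_poly (n - d) (f j).
have sr j : (size (r j) <= d.+1)%N.
  rewrite /r; case: (leqP n d) => [le|lt].
    by apply: leq_trans (size_polyMleq _ _) _; rewrite size_polyXn; move: (sf j) le; lia.
  by rewrite size_drop_poly; move: (sf j) lt; lia.
have topr j : (r j)`_d = (f j)`_n.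
  rewrite /r; case: (leqP n d) => [le|lt].
    by rewrite coefXnM ltnNge leq_subr /= subKn.
  by rewrite coef_drop_poly subnKC // ltnW.
pose h' j := h j + (- ka)%:P * r j.
have crossh' i : cross h' f i = cross h f i + (- ka)%:P * cross r f i.
  by rewrite /h' crossDl crossZl.
have [|i|la hla] := IH h'.
- move=> j; apply/leq_sizeP => l; rewrite leq_eqVlt => /orP[/eqP <-|lt].
    by rewrite coefD coefCM topr top mulNr subrr.
  rewrite coefD coefCM !nth_default ?mulr0 ?addr0 //.
    exact: leq_trans (sr j) _.
  exact: leq_trans (sh j) _.
- rewrite crossh'; apply: leq_trans (size_polyD _ _) _; rewrite geq_max sc /=.
  have [-> | k0] := eqVneq ka 0; first by rewrite oppr0 mul0r size_poly0.
  rewrite size_Cmul ?oppr_eq0 // /r; case: (leqP n d) => [le|lt].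
    by rewrite crossZl cross_self mulr0 size_poly0.
  by apply: size_cross_drop; rewrite subn_gt0 lt leq_subr.
have eh i : cross h f i = cross h' f i + ka%:P * cross r f i.
  by rewrite crossh' polyCN; ring.
case: (leqP n d) => [le|lt].
  exists la => i; rewrite eh -hla /r.
  by case: (leqP n d) le => // le _; rewrite crossZl cross_self mulr0 mulr0 addr0.
(* Index a stands for [del a.+1], so the syzygy built on [drop_poly (n - d) f] has index n -
   d.+1. *)
have lt' : (n - d.+1 < n)%N by move: lt; lia.
exists (fun a => la a + (if a == Ordinal lt' then ka else 0)) => i.
rewrite eh hla (eq_bigr _ (fun a _ => scalerDl _ _ _)) big_split /=; congr (_ + _).
rewrite (bigD1 (Ordinal lt')) //= eqxx big1 => [|a /negbTE->]; last by rewrite scale0r.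
rewrite addr0 mul_polyC /del /r; case: (leqP n d) lt => // lt _.
by rewrite subnSK.
Qed.

(** By the triple product formula and the relation \sum b f = 1, a syzygy g equals f x (g x b),
    hence is a cross product with f, though of factors of uncontrolled degree. *)
Lemma cross_span (g : 'I_3 -> {poly F}) :
  (forall i, (size (g i) <= n)%N) -> \sum_i g i * f i = 0 ->
  exists la : 'I_n -> F, forall i, g i = \sum_a la a *: del a.+1 i.
Proof.
move=> sg gf; pose h j := - cross g b j.
have gE i : g i = cross h f i.
  by rewrite crossNl cross_crossr bf gf mulr1 mulr0 subr0.
have [] := @cross_span_bounded h (\max_i size (h i)).
- by move=> i; apply: leq_bigmax.
- by move=> i; rewrite -gE.
by move=> la hla; exists la => i; rewrite gE hla.
Qed.

(** A relation says that the combination [h] of the truncations is parallel to f. By the Bezout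
    relation h is then a multiple of f, and it has degree < n while [f i0] has degree n, so h =
    0. *)
Lemma cross_free (la : 'I_n -> F) :
  (forall i, \sum_a la a *: del a.+1 i = 0) -> forall a, la a = 0.
Proof.
move=> H; pose h j := \sum_(a < n) (la a)%:P * drop_poly a.+1 (f j).
have hf i : cross h f i = 0.
  rewrite cross_suml -[RHS](H i); apply: eq_bigr => a _.
  by rewrite crossZl mul_polyC.
have sh i : (size (h i) <= n)%N.
  apply: leq_trans (size_sum _ _ _) _; apply/bigmax_leqP => a _.
  have [->|l0] := eqVneq (la a) 0; first by rewrite mul0r size_poly0.
  by rewrite size_Cmul // size_drop_poly leq_subLR (leq_trans (sf i)) // addSn ltnS leq_addl.
have hE i : h i = (\sum_j b j * h j) * f i.
  have := cross_crossr b h f i.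
  rewrite {1}/cross !hf !mulr0 subrr.
  under eq_bigr do rewrite mulrC.
  under [X in _ - f i * X]eq_bigr do rewrite mulrC.
  by rewrite bf mulr1 mulrC => /esym/eqP; rewrite subr_eq0 => /eqP.
have h0 i : h i = 0.
  rewrite hE; set q := \sum_j _.
  have [->|q0] := eqVneq q 0; first by rewrite mul0r.
  have := sh i0; rewrite hE -/q leqNgt => /negP[].
  have fi0 : f i0 != 0 by apply: contraNneq fn => ->; rewrite coef0.
  have sfi : (n < size (f i0))%N.
    by rewrite ltnNge; apply: contraNN fn => /leq_sizeP ->.
  rewrite size_mul //; have := q0; rewrite -size_poly_gt0.
  by move: (size q) (size (f i0)) sfi; lia.
case=> a; elim/ltn_ind: a => a IH lt.
(* Coefficient n - a.+1 of [drop_poly q.+1 (f i0)] is coefficient n - a + q of [f i0]: the top one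
   for q = a, zero for q > a; the terms with q < a vanish by induction. *)
have := congr1 (fun p : {poly F} => p`_(n - a.+1)) (h0 i0).
rewrite coef0 coef_sum (bigD1 (Ordinal lt)) //= coefCM coef_drop_poly subnK //.
rewrite big1 ?addr0 => [/eqP|q qa].
  by rewrite mulf_eq0 (negbTE fn) orbF => /eqP.
rewrite coefCM; case: (ltngtP q a) => [lq|gq|e].
- by have := IH q lq (ltn_ord q); rewrite (_ : Ordinal _ = q) => [->|]; [rewrite mul0r|exact: val_inj].
- rewrite coef_drop_poly nth_default ?mulr0 //; apply: leq_trans (sf _) _.
  by move: gq (lt); lia.
- by case/eqP: qa; apply: val_inj.
Qed.
End Univariate.

(** * Injectivity of the Sylvester map *)

(** Choosing y for each vector of a basis of the kernel defines an endomorphism of the kernel whose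
    graph lies in R by linearity; over a closed field it has an eigenvector. *)
Lemma relation_eigenvector (L : closedFieldType) d e (S : 'M[L]_(d, e))
    (R : 'rV[L]_d -> 'rV[L]_d -> Prop) :
  R 0 0 -> (forall x y x' y', R x y -> R x' y' -> R (x + x') (y + y')) ->
  (forall a x y, R x y -> R (a *: x) (a *: y)) ->
  (forall x, x *m S = 0 -> exists2 y, y *m S = 0 & R x y) ->
  (exists2 x : 'rV_d, x != 0 & x *m S = 0) ->
  exists (x : 'rV_d) mu, x != 0 /\ R x (mu *: x).
Proof.
move=> R0 RD RZ RS [x0 x0n x0S].
set B := row_base (kermx S).
have BS : B *m S = 0 by apply/sub_kermxP; rewrite eq_row_base.
have r0 : (0 < \rank (kermx S))%N.
  rewrite lt0n mxrank_eq0; apply: contraNneq x0n => k0.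
  by move/sub_kermxP: x0S; rewrite k0 submx0.
have /fin_all_exists[f fP] : forall k, exists y, y *m S = 0 /\ R (row k B) y.
  move=> k; case: (RS (row k B)) => [|y]; last by exists y.
  by rewrite -row_mul BS row0.
pose Y := \matrix_k f k.
have [C YC] : exists C, Y = C *m B.
  apply/submxP; rewrite eq_row_base; apply/sub_kermxP/row_matrixP => k.
  by rewrite row_mul rowK row0; case: (fP k).
have [mu] : exists mu, root (char_poly C) mu.
  by apply/closed_rootP; rewrite size_char_poly eqSS -lt0n.
rewrite -eigenvalue_root_char => /eigenvalueP[u uC u0].
exists (u *m B), mu; split.
  apply: contraNneq u0 => uB; apply/eqP.
  by apply: (row_free_inj (row_base_free (kermx S))); rewrite mul0mx.
rewrite scalemxAl -uC -mulmxA -YC.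
rewrite (mulmx_sum_row u B) (mulmx_sum_row u Y).
apply: (big_ind2 R) => // k _; rewrite rowK; apply: RZ.
by case: (fP k).
Qed.

(* The coefficient of s^y1 t^y2 in s^x1 t^x2 \sum_(j, k) c j k s^j t^k, for
   polynomials dehomogenized by u = v = 1. *)
Definition toep (A : nmodType) (c : nat -> nat -> A) (y1 y2 x1 x2 : nat) : A :=
  if (x1 <= y1)%N && (x2 <= y2)%N then c (y1 - x1)%N (y2 - x2)%N else 0.

Definition syl (A : nmodType) m n (c : 'I_3 -> nat -> nat -> A)
    (y : 'I_(3 * m) * 'I_(2 * n)) (x : 'I_3 * ('I_(2 * m) * 'I_n)) : A :=
  toep (c x.1) y.1 y.2 x.2.1 x.2.2.

Lemma coefM_top (R : nzRingType) (p q : {poly R}) a b :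
  (size p <= a.+1)%N -> (size q <= b.+1)%N -> (p * q)`_(a + b) = p`_a * q`_b.
Proof.
move=> sp sq; have la : (a < (a + b).+1)%N by rewrite ltnS leq_addr.
rewrite coefM (bigD1 (Ordinal la)) //= addKn big1 ?addr0 // => i.
rewrite -val_eqE /= => ia.
case: (ltngtP i a) => [lt|gt|e]; last by rewrite e eqxx in ia.
  rewrite [q`__]nth_default ?mulr0 //; apply: leq_trans sq _.
  by move: lt; lia.
by rewrite [p`__]nth_default ?mul0r //; apply: leq_trans sp _.
Qed.

Lemma size_coefM (R : nzRingType) (p q : {poly {poly R}}) a b j :
  (forall i, (size (p`_i)%R <= a)%N) -> (forall i, (size (q`_i)%R <= b)%N) ->
  (size ((p * q)`_j)%R <= (a + b).-1)%N.
Proof.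
move=> hp hq; rewrite coefM; apply: leq_trans (size_sum _ _ _) _.
apply/bigmax_leqP => i _; apply: leq_trans (size_polyMleq _ _) _.
by rewrite -!subn1 leq_sub2r // leq_add.
Qed.

(** The outer variable is s and the inner one t, so evaluation at [s%:P] leaves a polynomial in
    t. *)
Definition bivar (A : nzRingType) m n (c : nat -> nat -> A) : {poly {poly A}} :=
  \poly_(j < m.+1) \poly_(k < n.+1) c j k.

Lemma coef_bivar (A : nzRingType) m n (c : nat -> nat -> A) j k :
  (forall j k, (m < j)%N || (n < k)%N -> c j k = 0) -> (bivar m n c)`_j`_k = c j k.
Proof.
move=> supp; rewrite coef_poly; case: ltnP => [lj|lj]; last by rewrite coef0 supp // lj.
by rewrite coef_poly; case: ltnP => [lk|lk] //; rewrite supp // lk orbT.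
Qed.

Section SylInjective.
Variables (L : closedFieldType) (m n : nat) (c : 'I_3 -> nat -> nat -> L).
Hypothesis (m0 : (0 < m)%N) (n0 : (0 < n)%N).

Definition bpoly (i : 'I_3) : {poly {poly L}} := bivar m n (c i).
Local Notation P := bpoly.

(** Three forms of degree n without common zero on P^1: the Bezout relation excludes the affine
    points, the nonzero top coefficient the point at infinity. *)
Definition coprime_top (f : 'I_3 -> {poly L}) :=
  (exists b, \sum_i b i * f i = 1) /\ exists i, (f i)`_n != 0.

Hypothesis supp : forall i j k, (m < j)%N || (n < k)%N -> c i j k = 0.
Hypothesis cop : forall s, coprime_top (fun i => (P i).[s%:P]).
Hypothesis copi : coprime_top (fun i => (P i)`_m).

Lemma coef_bpoly i j k : (P i)`_j`_k = c i j k.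
Proof. exact/coef_bivar/supp. Qed.

Lemma size_bpoly i : (size (P i) <= m.+1)%N.
Proof. exact: size_poly. Qed.

Lemma size_coef_bpoly i j : (size ((P i)`_j)%R <= n.+1)%N.
Proof. by apply/leq_sizeP => k lk; rewrite coef_bpoly supp // lk orbT. Qed.

Let dropT k (p : {poly {poly L}}) := map_poly (drop_poly k) p.
Let takeT k (p : {poly {poly L}}) := map_poly (take_poly k) p.

Lemma coef_dropT k p j : (dropT k p)`_j = drop_poly k p`_j.
Proof. by rewrite coef_map_id0 // drop_poly0r. Qed.

Lemma coef_takeT k p j : (takeT k p)`_j = take_poly k p`_j.
Proof. by rewrite coef_map_id0 // take_poly0r. Qed.

Lemma size_dropT k p : (size (dropT k p) <= size p)%N.
Proof. by apply/leq_sizeP => j lj; rewrite coef_dropT nth_default // drop_poly0r. Qed.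

Lemma horner_dropT k p s : (dropT k p).[s%:P] = drop_poly k p.[s%:P].
Proof.
rewrite (horner_coef_wide _ (size_dropT k p)) horner_coef drop_poly_sum.
apply: eq_bigr => i _; rewrite coef_dropT -polyC_exp !(mulrC _ (_ ^+ _)%:P).
by rewrite !mul_polyC drop_polyZ.
Qed.

Let Delta (a : 'I_n) i := cross (fun j => dropT a.+1 (P j)) P i.
Let del (f : 'I_3 -> {poly L}) k i := cross (fun j => drop_poly k (f j)) f i.

Lemma size_horner_bpoly i s : (size (P i).[s%:P] <= n.+1)%N.
Proof.
rewrite horner_coef; apply: leq_trans (size_sum _ _ _) _; apply/bigmax_leqP => j _.
rewrite -polyC_exp mulrC mul_polyC; apply: leq_trans (size_scale_leq _ _) _.
exact: size_coef_bpoly.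
Qed.

Lemma horner_Delta a i s : (Delta a i).[s%:P] = del (fun i => (P i).[s%:P]) a.+1 i.
Proof. by rewrite /Delta /cross hornerD hornerN !hornerM !horner_dropT. Qed.

Lemma coef0_Delta a i : (Delta a i)`_0 = del (fun i => (P i)`_0) a.+1 i.
Proof. by rewrite /Delta /cross coefB !coef0M !coef_dropT. Qed.

(** As a form of degree 2m in s, [Delta a] takes at s = infinity its coefficient of index m + m. *)
Lemma coeftop_Delta a i : (Delta a i)`_(m + m) = del (fun i => (P i)`_m) a.+1 i.
Proof.
have s1 j := size_bpoly j.
have s2 j : (size (dropT a.+1 (P j)) <= m.+1)%N by apply: leq_trans (size_dropT _ _) _.
by rewrite /Delta /cross coefB !coefM_top // !coef_dropT.
Qed.

Lemma size_Delta a i : (size (Delta a i) <= (m + m).+1)%N.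
Proof.
have h j l : (size (dropT a.+1 (P j) * P l)%R <= (m + m).+1)%N.
  apply: leq_trans (size_polyMleq _ _) _.
  have := size_dropT a.+1 (P j); have := size_bpoly j; have := size_bpoly l.
  by move: (size (P l)) (size (dropT _ _)) (size (P j)); lia.
by rewrite /Delta /cross; apply: leq_trans (size_polyD _ _) _; rewrite size_polyN geq_max !h.
Qed.

Lemma size_coef_Delta a i j : (size ((Delta a i)`_j)%R <= n)%N.
Proof.
have -> : Delta a i = cross (fun j => dropT a.+1 (P j)) (fun j => takeT a.+1 (P j)) i.
  rewrite /Delta -[RHS](cross_shift ('X^(a.+1))%:P).
  have e l : takeT a.+1 (P l) + ('X^(a.+1))%:P * dropT a.+1 (P l) = P l.
    apply/polyP => k; rewrite coefD coefCM coef_dropT coef_takeT.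
    by rewrite mulrC poly_take_drop.
  by rewrite /cross !e.
have s1 l k : (size ((dropT a.+1 (P l))`_k)%R <= n - a)%N.
  by rewrite coef_dropT size_drop_poly leq_subLR addSn subnKC ?size_coef_bpoly // ltnW.
have s2 l k : (size ((takeT a.+1 (P l))`_k)%R <= a.+1)%N by rewrite coef_takeT size_take_poly.
have h k l : (size ((dropT a.+1 (P k) * takeT a.+1 (P l))`_j)%R <= n)%N.
  apply: leq_trans (size_coefM _ (s1 k) (s2 l)) _.
  by rewrite addnS /= subnK // ltnW.
by rewrite /cross coefB; apply: leq_trans (size_polyD _ _) _; rewrite size_polyN geq_max !h.
Qed.

Local Notation J := ('I_3 * ('I_(2 * m) * 'I_n))%type.
Let vpoly (v : 'rV[L]_#|{: J}|) i : {poly {poly L}} :=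
  \sum_(x : 'I_(2 * m) * 'I_n) (v 0 (enum_rank ((i, x) : J)) *: 'X^(x.2)) *: 'X^(x.1).

Lemma coef_vpoly v i (a : 'I_(2 * m)) (b : 'I_n) :
  (vpoly v i)`_a`_b = v 0 (enum_rank ((i, (a, b)) : J)).
Proof.
rewrite coef_sum coef_sum (bigD1 (a, b)) //= !coefZ !coefXn !eqxx mulr1 coefZ coefXn eqxx mulr1.
rewrite big1 ?addr0 // => -[a' b'] /= ne; rewrite !coefZ !coefXn.
have [e|ne1] := eqVneq (a : nat) a'; last by rewrite mulr0 coef0.
rewrite mulr1 coefZ coefXn; have [e'|ne2] := eqVneq (b : nat) b'; last by rewrite mulr0.
by case/eqP: ne; congr pair; apply: val_inj.
Qed.

Lemma size_vpoly v i : (size (vpoly v i) <= 2 * m)%N.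
Proof.
apply: leq_trans (size_sum _ _ _) _; apply/bigmax_leqP => x _.
by apply: leq_trans (size_scale_leq _ _) _; rewrite size_polyXn.
Qed.

Lemma size_coef_vpoly v i j : (size ((vpoly v i)`_j)%R <= n)%N.
Proof.
rewrite coef_sum; apply: leq_trans (size_sum _ _ _) _; apply/bigmax_leqP => x _.
rewrite coefZ coefXn; case: eqP => _; rewrite ?mulr0 ?size_poly0 // mulr1.
by apply: leq_trans (size_scale_leq _ _) _; rewrite size_polyXn.
Qed.

Lemma vpoly_onto (G : 'I_3 -> {poly {poly L}}) :
  (forall i, (size (G i) <= 2 * m)%N) -> (forall i j, (size ((G i)`_j)%R <= n)%N) ->
  exists v, forall i, vpoly v i = G i.
Proof.
move=> s1 s2; exists (\row_q let x := enum_val q : J in (G x.1)`_(x.2.1)`_(x.2.2)) => i.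
apply/polyP => a; apply/polyP => b.
have [la|la] := ltnP a (2 * m); last first.
  by rewrite !(nth_default 0 (leq_trans _ la)) // size_vpoly.
have [lb|lb] := ltnP b n; last first.
  by rewrite !(nth_default 0 (leq_trans _ lb)) // size_coef_vpoly.
by rewrite (coef_vpoly _ i (Ordinal la) (Ordinal lb)) mxE enum_rankK.
Qed.

Lemma coef_syl v y1 y2 : (\sum_i vpoly v i * P i)`_y1`_y2 =
  \sum_(x : J) v 0 (enum_rank x) * toep (c x.1) y1 y2 x.2.1 x.2.2.
Proof.
rewrite !coef_sum; under eq_bigr => i _ do rewrite big_distrl /= !coef_sum.
rewrite pair_bigA /=; apply: eq_bigr => -[i [a b]] _ /=.
rewrite -scalerAl coefZ coefXnM /toep; case: ltnP => [lt|le] /=; first by rewrite mulr0 coef0 mulr0.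
rewrite -scalerAl coefZ coefXnM; case: ltnP => [lt|le'] /=; first by rewrite !mulr0.
by rewrite coef_bpoly.
Qed.

Let S : 'M[L]_(#|{: J}|, #|{: 'I_(3 * m) * 'I_(2 * n)}|) :=
  \matrix_(p, q) syl c (enum_val q) (enum_val p).

Lemma syl_mxP v : v *m S = 0 <-> \sum_i vpoly v i * P i = 0.
Proof.
have E (y : 'I_(3 * m) * 'I_(2 * n)) :
    (v *m S) 0 (enum_rank y) = (\sum_i vpoly v i * P i)`_(y.1)`_(y.2).
  rewrite mxE coef_syl (reindex (@enum_rank {: J})) /=; last exact/onW_bij/enum_rank_bij.
  by apply: eq_bigr => x _; rewrite mxE !enum_rankK.
split=> h; last first.
  by apply/rowP => q; rewrite -(enum_valK q) E h !coef0 mxE.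
apply/polyP => y1; apply/polyP => y2; rewrite !coef0.
have [l1|l1] := ltnP y1 (3 * m); last first.
  suff -> : (\sum_i vpoly v i * P i)`_y1 = 0 by rewrite coef0.
  apply: nth_default; apply: leq_trans (size_sum _ _ _) _.
  apply/bigmax_leqP => i _; apply: leq_trans (size_polyMleq _ _) _.
  by move: (size_vpoly v i) (size_bpoly i) l1 m0; lia.
have [l2|l2] := ltnP y2 (2 * n); last first.
  rewrite coef_sum nth_default //; apply: leq_trans (size_sum _ _ _) _.
  apply/bigmax_leqP => i _.
  apply: leq_trans (size_coefM _ (size_coef_vpoly v i) (size_coef_bpoly i)) _.
  by move: l2 n0; lia.
by rewrite -(E (Ordinal l1, Ordinal l2)) h mxE.
Qed.

(* The syzygies [Delta a], of bidegree (2m, n-1), are independent at every point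
   of P^1 and span at s = 0 the syzygies of degree < n in t.  So a syzygy [G] of
   s-degree < 2m is [\sum_a la a Delta a + s G'] with [G'] of the same kind.  For
   an eigenvector, (1 - mu s) G = [\sum_a la a Delta a], and evaluating at
   s = 1 / mu, possibly infinite, gives [la = 0]. *)
Lemma syl_injective v : (forall y, \sum_(x : J) syl c y x * v x = 0) -> forall x, v x = 0.
Proof.
move=> hv; apply: NNPP => /not_all_ex_not [x0 x0v].
pose R (x y : 'rV[L]_#|{: J}|) := exists la : 'I_n -> L, forall i,
  vpoly x i = \sum_a (la a)%:P *: Delta a i + 'X * vpoly y i.
have vpolyD x y i : vpoly (x + y) i = vpoly x i + vpoly y i.
  by rewrite /vpoly -big_split; apply: eq_bigr => z _; rewrite mxE !scalerDl.
have vpolyZ a x i : vpoly (a *: x) i = a%:P *: vpoly x i.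
  rewrite /vpoly scaler_sumr; apply: eq_bigr => z _.
  by rewrite mxE scalerA mul_polyC scalerA.
have vpoly0 i : vpoly 0 i = 0 by have := vpolyZ 0 0 i; rewrite !scale0r.
have [|||||x [mu [xn [la hla]]]] := @relation_eigenvector L _ _ S R.
- by exists (fun=> 0) => i; rewrite vpoly0 mulr0 addr0 big1 // => a _; rewrite scale0r.
- move=> x y x' y' [la h] [la' h']; exists (fun a => la a + la' a) => i.
  rewrite !vpolyD h h' mulrDr addrACA -big_split; congr (_ + _).
  by apply: eq_bigr => a _; rewrite polyCD scalerDl.
- move=> a x y [la h]; exists (fun k => a * la k) => i.
  rewrite !vpolyZ h scalerDr scaler_sumr scalerAr; congr (_ + _).
  by apply: eq_bigr => k _; rewrite polyCM scalerA.
- move=> x /syl_mxP xS.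
  have [[b hb] [i0 hi0]] := cop 0.
  have e0 i : (P i).[0%:P] = (P i)`_0 by rewrite polyC0 horner_coef0.
  have [|||||la hla] := @cross_span L n (fun i => (P i)`_0) b _ _ i0 _ (fun i => (vpoly x i)`_0).
  + by move=> i; apply: size_coef_bpoly.
  + by rewrite -hb; apply: eq_bigr => i _; rewrite e0.
  + by rewrite -e0.
  + by move=> i; apply: size_coef_vpoly.
  + have := congr1 (fun p : {poly {poly L}} => p`_0) xS; rewrite coef0 coef_sum => h; rewrite -[RHS]h.
    by apply: eq_bigr => i _; rewrite coef0M.
  pose H i := vpoly x i - \sum_a (la a)%:P *: Delta a i.
  have H0 i : H i = 'X * drop_poly 1 (H i).
    rewrite mulrC -{1}(poly_take_drop 1 (H i)).
    suff -> : take_poly 1 (H i) = 0 by rewrite add0r.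
    apply/polyP => -[|k]; rewrite coef_take_poly coef0 //=.
    rewrite coefB hla coef_sum -sumrB big1 // => a _.
    by rewrite coefZ coef0_Delta -mul_polyC subrr.
  have [||y hy] := @vpoly_onto (fun i => drop_poly 1 (H i)).
  + move=> i; rewrite size_drop_poly leq_subLR add1n; apply: leq_trans (size_polyD _ _) _.
    rewrite geq_max (leq_trans (size_vpoly x i)) //= size_polyN.
    apply: leq_trans (size_sum _ _ _) _; apply/bigmax_leqP => a _.
    apply: leq_trans (size_scale_leq _ _) _; apply: leq_trans (size_Delta _ _) _.
    by rewrite mul2n -addnn.
  + move=> i j; rewrite coef_drop_poly coefB; apply: leq_trans (size_polyD _ _) _.
    rewrite geq_max size_coef_vpoly size_polyN coef_sum.
    apply: leq_trans (size_sum _ _ _) _; apply/bigmax_leqP => a _.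
    rewrite coefZ mul_polyC; apply: leq_trans (size_scale_leq _ _) _.
    exact: size_coef_Delta.
  have Hy i : vpoly x i = \sum_a (la a)%:P *: Delta a i + 'X * vpoly y i.
    by rewrite hy -H0 addrC subrK.
  exists y; last by exists la.
  apply/syl_mxP; apply: (mulfI (x := 'X)); first by rewrite polyX_eq0.
  have D0 : \sum_i (\sum_a (la a)%:P *: Delta a i) * P i = 0.
    under eq_bigr do rewrite big_distrl /=.
    rewrite exchange_big big1 //= => a _.
    transitivity ((la a)%:P *: \sum_i Delta a i * P i).
      by rewrite scaler_sumr; apply: eq_bigr => i _; rewrite scalerAl.
    by rewrite cross_dot scaler0.
  have E : \sum_i vpoly x i * P i =
      \sum_i (\sum_a (la a)%:P *: Delta a i) * P i + 'X * \sum_i vpoly y i * P i.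
    rewrite big_distrr -big_split; apply: eq_bigr => i _ /=.
    by rewrite Hy mulrDl mulrA.
  by rewrite mulr0 -[RHS]xS E D0 add0r.
- exists (\row_q v (enum_val q)).
    by apply/rV0Pn; exists (enum_rank x0); rewrite mxE enum_rankK; apply/eqP.
  apply/rowP => q; rewrite !mxE -[RHS](hv (enum_val q)).
  rewrite [RHS](reindex (@enum_val {: J} predT)) /=; last exact/onW_bij/enum_val_bij.
  by apply: eq_bigr => p _; rewrite !mxE mulrC.
have main i : (1 - mu%:P *: 'X) * vpoly x i = \sum_a (la a)%:P *: Delta a i.
  by rewrite mulrBl mul1r {1}hla vpolyZ -scalerAl -scalerAr addrK.
have la0 : forall a, la a = 0.
  (* For mu = 0 the evaluation point is s = infinity, where the left side of [main] vanishes because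
     its s-degree is below 2m. *)
  have [mu0|mu0] := eqVneq mu 0.
    have [[b hb] [i0 hi0]] := copi.
    apply: (@cross_free L n (fun i => (P i)`_m) b _ hb i0 hi0) => [i|i].
      exact: size_coef_bpoly.
    have := congr1 (fun p : {poly {poly L}} => p`_(m + m)) (main i).
    rewrite mu0 scale0r subr0 mul1r nth_default; last by rewrite addnn -mul2n size_vpoly.
    move=> h; rewrite [RHS]h coef_sum; apply: eq_bigr => a _.
    by rewrite coefZ coeftop_Delta mul_polyC.
  have [[b hb] [i0 hi0]] := cop mu^-1.
  apply: (@cross_free L n _ b _ hb i0 hi0) => [i|i].
    exact: size_horner_bpoly.
  have := congr1 (fun p : {poly {poly L}} => p.[(mu^-1)%:P]) (main i).
  rewrite hornerM hornerD hornerN hornerZ hornerX hornerC -polyCM mulfV // subrr mul0r.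
  move=> h; rewrite [RHS]h horner_sum; apply: eq_bigr => a _.
  by rewrite hornerZ horner_Delta mul_polyC.
have x0' i : vpoly x i = 0.
  have := main i; rewrite big1 => [/eqP|a _]; last by rewrite la0 scale0r.
  rewrite mulf_eq0 => /orP[/eqP h|/eqP//].
  have := congr1 (fun p : {poly {poly L}} => p.[0]) h.
  rewrite hornerD hornerN hornerZ hornerX mulr0 hornerC subr0 horner0 => /eqP.
  by rewrite oner_eq0.
case/negP: xn; apply/eqP/rowP => q; rewrite mxE -(enum_valK q).
by case: (enum_val q) => i [a b]; rewrite -coef_vpoly x0' !coef0.
Qed.
End SylInjective.

(** * Common zeros and the kernel of the Sylvester matrix *)

Definition extend (A : nmodType) m n (a : 'I_m.+1 -> 'I_n.+1 -> A) (j k : nat) : A :=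
  if (j <= m)%N && (k <= n)%N then a (inord j) (inord k) else 0.

Lemma extend_ord (A : nmodType) m n (a : 'I_m.+1 -> 'I_n.+1 -> A) (j : 'I_m.+1) (k : 'I_n.+1) :
  extend a j k = a j k.
Proof. by rewrite /extend !leq_ord !inord_val. Qed.

Lemma extend_out (A : nmodType) m n (a : 'I_m.+1 -> 'I_n.+1 -> A) j k :
  (m < j)%N || (n < k)%N -> extend a j k = 0.
Proof. by rewrite !ltnNge -negb_and /extend => /negbTE ->. Qed.

Lemma meval_bimon (A : comNzRingType) m n (jk : bidx m n) (s u t v : A) :
  ('X_[bimon jk]).@[tnth [tuple s; u; t; v]] =
  s ^+ jk.1 * u ^+ (m - jk.1) * (t ^+ jk.2 * v ^+ (n - jk.2)).
Proof.
rewrite mevalX !big_ord_recl big_ord0 mulr1 !multinomE !(tnth_nth 0%N) !(tnth_nth 0) /=.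
by rewrite mulrA.
Qed.

Lemma meval_bipoly (A : comNzRingType) m n (a : 'I_m.+1 -> 'I_n.+1 -> A) (s u t v : A) :
  (bipoly a).@[tnth [tuple s; u; t; v]] =
  \sum_j \sum_k a j k * (s ^+ j * u ^+ (m - j) * (t ^+ k * v ^+ (n - k))).
Proof.
rewrite raddf_sum; apply: eq_bigr => j _; rewrite raddf_sum; apply: eq_bigr => k _.
by rewrite /= mevalZ meval_bimon.
Qed.

Lemma bezout3 (L : closedFieldType) (f : 'I_3 -> {poly L}) :
  (forall t, exists i, (f i).[t] != 0) -> exists b, \sum_i b i * f i = 1.
Proof.
move=> nz; pose i1 := next3 ord0; pose i2 := next3 i1.
have [[u v] /= e1] := Bezoutp (f ord0) (f i1).
have [[w x] /= e2] := Bezoutp (gcdp (f ord0) (f i1)) (f i2).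
have cop : size (gcdp (gcdp (f ord0) (f i1)) (f i2)) == 1%N.
  apply: contraT => /closed_rootP[t]; rewrite !root_gcd => /andP[/andP[r0 r1] r2].
  have [i] := nz t; have : i \in [:: ord0; i1; i2].
    by rewrite !inE -!val_eqE; case: (i) => [[|[|[|//]]] ?].
  by rewrite !inE => /or3P[] /eqP->; rewrite -/(root _ _) ?r0 ?r1 ?r2.
have [[u' v'] /= e3] : exists uv, uv.1 * f ord0 + uv.2 * f i1 = gcdp (f ord0) (f i1).
  move/eqpP: (e1) => [[a b] /= /andP[a0 b0] e].
  exists (b^-1 *: (a *: u), b^-1 *: (a *: v)) => /=.
  by rewrite -!scalerAl -!scalerDr e scalerA mulVf // scale1r.
have := eqp_size e2; rewrite (eqP cop) => /eqP/size_poly1P[z z0 ez].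
exists (fun i => z^-1 *: (if i == ord0 then w * u' else if i == i1 then w * v' else x)).
rewrite (sum3 _ ord0) /= -!scalerAl -!scalerDr -!mulrA -mulrDr e3 ez.
by rewrite -mul_polyC -polyCM mulVf.
Qed.

Section CommonZero.
Variables (L : closedFieldType) (m n : nat) (a : 'I_3 -> 'I_m.+1 -> 'I_n.+1 -> L).
Hypothesis (m0 : (0 < m)%N) (n0 : (0 < n)%N).
Let c i := extend (a i).
Let supp i j k : (m < j)%N || (n < k)%N -> c i j k = 0 := @extend_out _ _ _ (a i) j k.

Lemma bpoly_horner i s t :
  ((bpoly m n c i).[s%:P]).[t] = \sum_j \sum_k a i j k * s ^+ j * t ^+ k.
Proof.
rewrite (horner_coef_wide _ (size_bpoly m n c i)) horner_sum; apply: eq_bigr => j _.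
rewrite hornerM -polyC_exp hornerC (horner_coef_wide _ (size_coef_bpoly supp i j)).
rewrite big_distrl; apply: eq_bigr => k _ /=.
by rewrite (coef_bpoly supp) /c extend_ord mulrAC.
Qed.

Lemma bpoly_horner_top i s :
  ((bpoly m n c i).[s%:P])`_n = \sum_j a i j ord_max * s ^+ j.
Proof.
rewrite (horner_coef_wide _ (size_bpoly m n c i)) coef_sum; apply: eq_bigr => j _.
by rewrite -polyC_exp coefMC (coef_bpoly supp) -(extend_ord (a i) j ord_max).
Qed.

Lemma bpoly_top_horner i t : ((bpoly m n c i)`_m).[t] = \sum_k a i ord_max k * t ^+ k.
Proof.
rewrite (horner_coef_wide _ (size_coef_bpoly supp i m)); apply: eq_bigr => k _.
by rewrite (coef_bpoly supp) -(extend_ord (a i) ord_max k).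
Qed.

(** By contraposition from [syl_injective]. The points (s:1) and (1:0) of the first factor give its
    two coprimality hypotheses; in each, the points (t:1) of the second factor give the Bezout
    relation and (1:0) the top coefficient. *)
Lemma isdet_syl0_zero : isdet (syl (m := m) (n := n) c) 0 ->
  has_biproj_zero (fun i => bipoly (a i)).
Proof.
move=> d0; apply: NNPP => nz.
have nzP s u t v : (s, u) != (0, 0) -> (t, v) != (0, 0) ->
    exists i, \sum_j \sum_k a i j k * (s ^+ j * u ^+ (m - j) * (t ^+ k * v ^+ (n - k))) != 0.
  move=> su tv; apply: NNPP => h; apply: nz; exists s, u, t, v; split=> // i.
  by rewrite meval_bipoly; apply/eqP/negPn/negP => h'; apply: h; exists i.
have one0 (x : L) : (x, 1 : L) != (0, 0) by rewrite xpair_eqE oner_eq0 andbF.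
have zero1 (x : L) : (1 : L, x) != (0, 0) by rewrite xpair_eqE oner_eq0.
have pick k (F : 'I_k.+1 -> L) : \sum_(j < k.+1) F j * (1 ^+ j * 0 ^+ (k - j)) = F ord_max.
  rewrite (bigD1 ord_max) //= subnn !expr1n expr0 !mulr1 big1 ?addr0 // => j jm.
  by rewrite expr0n subn_eq0 leqNgt ltn_neqAle -ltnS ltn_ord andbT jm !mulr0.
have [x [j xj] xk] := isdet0_kernel d0; case/eqP: xj.
apply: (@syl_injective L m n c m0 n0 supp _ _ x xk) => [s|].
- split.
    apply: bezout3 => t; have [i hi] := nzP s 1 t 1 (one0 s) (one0 t); exists i.
    rewrite bpoly_horner; apply: contraNneq hi => h; rewrite -[eqbRHS]h; apply/eqP.
    by apply: eq_bigr => j' _; apply: eq_bigr => k _; rewrite !expr1n !mulr1 mulrA.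
  have [i hi] := nzP s 1 1 0 (one0 s) (zero1 0); exists i.
  rewrite bpoly_horner_top; apply: contraNneq hi => h; rewrite -[eqbRHS]h; apply/eqP.
  apply: eq_bigr => j' _; rewrite -(pick _ (fun k => a i j' k * s ^+ j')).
  by apply: eq_bigr => k _; rewrite expr1n mulr1 !mulrA.
- split.
    apply: bezout3 => t; have [i hi] := nzP 1 0 t 1 (zero1 0) (one0 t); exists i.
    rewrite bpoly_top_horner; apply: contraNneq hi => h; rewrite -[eqbRHS]h; apply/eqP.
    rewrite exchange_big; apply: eq_bigr => k _ /=.
    rewrite -(pick _ (fun j => a i j k * t ^+ k)).
    by apply: eq_bigr => j' _; rewrite (expr1n _ (n - k)) mulr1 mulrA mulrAC.
  have [i hi] := nzP 1 0 1 0 (zero1 0) (zero1 0); exists i.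
  rewrite (coef_bpoly supp) (_ : c i m n = a i ord_max ord_max); last first.
    exact: (extend_ord (a i) ord_max ord_max).
  apply: contraNneq hi => h; rewrite -[eqbRHS]h; apply/eqP.
  rewrite -(pick _ (fun j => a i j ord_max)); apply: eq_bigr => j' _.
  rewrite -(pick _ (fun k => a i j' k)) big_distrl; apply: eq_bigr => k _ /=.
  by rewrite -[RHS]mulrA; congr (_ * _); rewrite mulrC.
Qed.

(** The values of the monomials at the common zero form a left kernel vector, nonzero since the
    monomial 1 has value 1. *)
Lemma syl_common_zero d s t : isdet (syl (m := m) (n := n) c) d ->
  (forall i, \sum_j \sum_k a i j k * s ^+ j * t ^+ k = 0) -> d = 0.
Proof.
move=> hd hz.
have l1 : (0 < 3 * m)%N by rewrite muln_gt0.
have l2 : (0 < 2 * n)%N by rewrite muln_gt0.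
pose x (y : 'I_(3 * m) * 'I_(2 * n)) := s ^+ y.1 * t ^+ y.2.
apply: (@isdet_left_kernel L _ _ _ d x (Ordinal l1, Ordinal l2) hd).
  by rewrite /x /= !expr0 mulr1 oner_neq0.
move=> [i [x1 x2]]; rewrite /syl /x /=.
pose Q := ('X^x2 *: 'X^x1) * bpoly m n c i.
have cQ y1 y2 : Q`_y1`_y2 = toep (c i) y1 y2 x1 x2.
  rewrite /Q -scalerAl coefZ coefXnM /toep; case: ltnP => _ /=; first by rewrite andbF.
  rewrite andbT coefXnM; case: ltnP => _ /=; first by rewrite coef0.
  by rewrite (coef_bpoly supp).
have s1 : (size Q <= 3 * m)%N.
  rewrite /Q -scalerAl; apply: leq_trans (size_scale_leq _ _) _.
  apply: leq_trans (size_polyMleq _ _) _; rewrite size_polyXn.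
  rewrite addSn /= (leq_trans (leq_add (leqnn x1) (size_bpoly m n c i))) //.
  by have := ltn_ord x1; lia.
have s2 j : (size (Q`_j)%R <= 2 * n)%N.
  apply/leq_sizeP => k lk; rewrite cQ /toep.
  case: ifP => // _; rewrite supp //; apply/orP; right.
  by move: (ltn_ord x2) lk; lia.
have : (Q.[s%:P]).[t] = 0.
  rewrite /Q !hornerM bpoly_horner hz mulr0 //.
rewrite (horner_coef_wide _ s1) horner_sum => h; rewrite -[RHS]h.
rewrite -(pair_bigA _ (fun (y1 : 'I_(3 * m)) (y2 : 'I_(2 * n)) =>
  s ^+ y1 * t ^+ y2 * toep (c i) y1 y2 x1 x2)) /=.
apply: eq_bigr => y1 _; rewrite hornerM -polyC_exp hornerC.
rewrite (horner_coef_wide _ (s2 y1)) big_distrl; apply: eq_bigr => y2 _ /=.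
by rewrite cQ; ring.
Qed.

End CommonZero.

(** * The Sylvester determinant is the resultant *)

Section EvalCoef.
Variables m n : nat.
Local Notation ZC := {mpoly int[#|cidx 3 m n|]}.

Definition eval_hom (A : comNzRingType) (a : 'I_3 -> 'I_m.+1 -> 'I_n.+1 -> A) :
    {rmorphism ZC -> A} :=
  mmap (intr : {rmorphism int -> A})
    (fun q => let ijk := enum_val q in a ijk.1.1 ijk.1.2 ijk.2).

Definition ucoef (i : 'I_3) (j : 'I_m.+1) (k : 'I_n.+1) : ZC :=
  'X_(enum_rank ((i, j, k) : cidx 3 m n)).

Lemma eval_ucoef (A : comNzRingType) (a : 'I_3 -> 'I_m.+1 -> 'I_n.+1 -> A) i j k :
  eval_hom a (ucoef i j k) = a i j k.
Proof. by rewrite /eval_hom /ucoef /= mmapX mmap1U enum_rankK. Qed.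

Lemma eval_hom_comp (A B : comNzRingType) (th : {rmorphism A -> B})
    (a : 'I_3 -> 'I_m.+1 -> 'I_n.+1 -> A) F :
  th (eval_hom a F) = eval_hom (fun i j k => th (a i j k)) F.
Proof.
rewrite /eval_hom /= /mmap rmorph_sum; apply: eq_bigr => w _.
rewrite rmorphM /= rmorph_int /mmap1 rmorph_prod; congr (_ * _).
by apply: eq_bigr => q _; rewrite rmorphXn.
Qed.

Lemma eq_eval_hom (A : comNzRingType) (a b : 'I_3 -> 'I_m.+1 -> 'I_n.+1 -> A) F :
  (forall i j k, a i j k = b i j k) -> eval_hom a F = eval_hom b F.
Proof.
move=> ab; rewrite /eval_hom /= /mmap; apply: eq_bigr => w _; congr (_ * _).
by apply: eq_bigr => q _; rewrite ab.
Qed.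

Lemma eval_hom_ucoef F : eval_hom ucoef F = F.
Proof.
rewrite [RHS]mpolyE /eval_hom /= /mmap; apply: eq_bigr => w _.
rewrite -mul_mpolyC -[in RHS](intz F@_w) -(rmorph_int (@mpolyC _ int)) mpolyXE_id.
congr (_ * _); apply: eq_bigr => q _; congr (_ ^+ _); rewrite /ucoef.
by congr ('X__); rewrite -[RHS]enum_valK; case: (enum_val q) => -[].
Qed.

End EvalCoef.

Lemma toep_map (A B : nmodType) (th : A -> B) (c : nat -> nat -> A) y1 y2 x1 x2 :
  th 0 = 0 -> th (toep c y1 y2 x1 x2) = toep (fun j k => th (c j k)) y1 y2 x1 x2.
Proof. by move=> th0; rewrite /toep; case: ifP. Qed.

Lemma eq_toep (A : nmodType) (c c' : nat -> nat -> A) y1 y2 x1 x2 :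
  c =2 c' -> toep c y1 y2 x1 x2 = toep c' y1 y2 x1 x2.
Proof. by move=> cc; rewrite /toep cc. Qed.

Lemma extend_map (A B : nmodType) (th : A -> B) m n (a : 'I_m.+1 -> 'I_n.+1 -> A) j k :
  th 0 = 0 -> th (extend a j k) = extend (fun j k => th (a j k)) j k.
Proof. by move=> th0; rewrite /extend; case: ifP. Qed.

(** [countable_algebraic_closure] takes a countable field, hence the encodings of polynomials by
    lists of terms and of fractions by pairs. *)
Lemma exists_closed_extension N :
  exists (L : closedFieldType) (th : {rmorphism {mpoly int[N]} -> L}), injective th.
Proof.
pose code (p : {mpoly int[N]}) := [seq (w, p@_w) | w <- msupp p].
pose decode (s : seq ('X_{1..N} * int)) : {mpoly int[N]} :=
  \sum_(x <- s) x.2 *: 'X_[x.1].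
have codeK : cancel code decode.
  by move=> p; rewrite /decode /code big_map /= -mpolyE.
pose cD := isCountable.Build {mpoly int[N]} (pcan_pickleK (can_pcan codeK)).
pose Dc : countType := HB.pack {mpoly int[N]} cD.
pose Q := {fraction {mpoly int[N]}}.
pose code2 (x : Q) : Dc * Dc := frac (repr x).
pose decode2 (y : Dc * Dc) : option Q :=
  omap (fun r : {ratio {mpoly int[N]}} => (\pi_Q r)%qT) (insub (y : {mpoly int[N]} * {mpoly int[N]})).
have codeK2 : pcancel code2 decode2.
  by move=> x; rewrite /decode2 /code2 valK /= reprK.
pose cK := isCountable.Build Q (pcan_pickleK codeK2).
pose K : countFieldType := HB.pack Q cK.
have [L [th _]] := countable_algebraic_closure K.
exists L, (th \o (@tofrac {mpoly int[N]} : {rmorphism {mpoly int[N]} -> Q})).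
by move=> x y /= /fmorph_inj /eqP; rewrite tofrac_eq => /eqP.
Qed.

Definition monoc (A : nzRingType) m n (j0 : 'I_m.+1) (k0 : 'I_n.+1) j k : A :=
  ((j == j0) && (k == k0))%:R.

Lemma sum_monoc (A : nzRingType) m n (j0 : 'I_m.+1) (k0 : 'I_n.+1)
    (X : 'I_m.+1 -> 'I_n.+1 -> A) :
  \sum_j \sum_k monoc A j0 k0 j k * X j k = X j0 k0.
Proof.
rewrite (bigD1 j0) //= (bigD1 k0) //= /monoc !eqxx mul1r !big1 ?addr0 // => [j jj|k kk].
  by rewrite big1 // => k _; rewrite (negbTE jj) mul0r.
by rewrite (negbTE kk) mul0r.
Qed.

(* s^m t^n, u^m v^n, s^m v^n + u^m t^n: without common zeros over any field. *)
Definition basec (A : nzRingType) m n (i : 'I_3) (j : 'I_m.+1) (k : 'I_n.+1) : A :=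
  match val i with
  | 0 => monoc A ord_max ord_max j k
  | 1 => monoc A ord0 ord0 j k
  | _ => monoc A ord_max ord0 j k + monoc A ord0 ord_max j k
  end.

Arguments basec A m n i j k : clear implicits.

Lemma basec_map (A B : nzRingType) (th : {rmorphism A -> B}) m n i j k :
  th (basec A m n i j k) = basec B m n i j k.
Proof. by rewrite /basec; case: (val i) => [|[|?]]; rewrite ?rmorphD /= !rmorph_nat. Qed.

Section Resultant.
Variables m n : nat.
Hypothesis (m0 : (0 < m)%N) (n0 : (0 < n)%N).
Local Notation ZC := {mpoly int[#|cidx 3 m n|]}.
Local Notation coeffs A := ('I_3 -> 'I_m.+1 -> 'I_n.+1 -> A).

Definition sylc (A : nmodType) (a : coeffs A) := syl (m := m) (n := n) (fun i => extend (a i)).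

Lemma sylc_map (A B : nmodType) (th : A -> B) (a : coeffs A) y x :
  th 0 = 0 -> th (sylc a y x) = sylc (fun i j k => th (a i j k)) y x.
Proof.
move=> th0; rewrite /sylc /syl toep_map //; apply: eq_toep => j k.
by rewrite extend_map.
Qed.

Lemma eq_sylc (A : nmodType) (a b : coeffs A) y x :
  (forall i j k, a i j k = b i j k) -> sylc a y x = sylc b y x.
Proof. by move=> ab; apply: eq_toep => j k; rewrite /extend ab. Qed.

Variable R : ZC.
Hypothesis hR : isdet (sylc (@ucoef m n)) R.

Lemma isdet_eval (A : comNzRingType) (a : coeffs A) : isdet (sylc a) (eval_hom a R).
Proof.
apply: eq_isdet (isdet_map (eval_hom a) hR) => y x.
rewrite sylc_map ?rmorph0 //; apply: eq_sylc => i j k; exact: eval_ucoef.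
Qed.

Lemma basec_no_zero (L : fieldType) :
  ~ has_biproj_zero (fun i => bipoly (basec L m n i)).
Proof.
move=> [s [u [t [v [su tv H]]]]].
have := H (inord 2); have := H (inord 1); have := H (inord 0).
have E (i : 'I_3) : (bipoly (basec L m n i)).@[tnth [tuple s; u; t; v]] =
   match val i with
   | 0 => s ^+ m * t ^+ n | 1 => u ^+ m * v ^+ n
   | _ => s ^+ m * v ^+ n + u ^+ m * t ^+ n end.
  rewrite meval_bipoly /basec; case: (val i) => [|[|k]].
  - by rewrite sum_monoc /= !subnn !expr0 !mulr1.
  - by rewrite sum_monoc /= !subn0 !expr0 !mul1r.
  - under eq_bigr do under eq_bigr do rewrite mulrDl.
    under eq_bigr do rewrite big_split /=.
    rewrite big_split /= !sum_monoc /= !subnn !subn0 !expr0.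
    by rewrite !mulr1 !mul1r.
rewrite !E /= !inordK //=.
have p (x : L) d : (0 < d)%N -> (x ^+ d == 0) = (x == 0) by move=> d0; rewrite expf_eq0 d0.
move=> /eqP; rewrite mulf_eq0 !p // => /orP[] /eqP z0 /eqP; rewrite mulf_eq0 !p //.
  have u0 : u != 0 by apply: contraNneq su => u0; rewrite z0 u0.
  rewrite (negbTE u0) /= => /eqP v0 /eqP.
  rewrite z0 v0 !expr0n !gtn_eqF //= mul0r add0r mulf_eq0 !p // (negbTE u0) /= => /eqP t0.
  by move: tv; rewrite t0 v0 eqxx.
have v0 : v != 0 by apply: contraNneq tv => v0; rewrite z0 v0.
rewrite (negbTE v0) orbF => /eqP u0 /eqP.
rewrite z0 u0 !expr0n !gtn_eqF //= mulr0 addr0 mulf_eq0 !p // (negbTE v0) orbF => /eqP s0.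
by move: su; rewrite s0 u0 eqxx.
Qed.

Lemma eval_neq0 (L : closedFieldType) (a : coeffs L) :
  ~ has_biproj_zero (fun i => bipoly (a i)) -> eval_hom a R != 0.
Proof.
move=> nz; apply/eqP => e; apply: nz; apply: (isdet_syl0_zero m0 n0).
by rewrite -e; apply: isdet_eval.
Qed.

Lemma isdet_basec (A : comNzRingType) : isdet (sylc (basec A m n)) 1.
Proof.
suff d1 : isdet (sylc (basec int m n)) 1.
  apply: eq_isdet (eq_rect _ _ (isdet_map (intr : {rmorphism int -> A}) d1) _ (rmorph1 _)).
  move=> y x; rewrite sylc_map ?rmorph0 //; apply: eq_sylc => i j k.
  exact: basec_map.
set d := eval_hom (basec int m n) R.
suff d1 : eqpm 1 d by apply: isdet_eqpm d1; apply: isdet_eval.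
suff /eqP : absz d == 1%N by case: (d) => [[|[|k]]|[|k]] //= _; [left|right].
apply: contraT => dn1.
have [p pP /dvdnP[q pd]] : exists2 p, prime p & (p %| absz d)%N.
  (* Every prime divides 0; 2 is an arbitrary choice. *)
  have [-> | d0] := eqVneq (absz d) 0; first by exists 2.
  exists (pdiv (absz d)); last exact: pdiv_dvd.
  by apply: pdiv_prime; case: (absz d) d0 dn1 => [|[|]].
have [L [th _]] := countable_algebraic_closure 'F_p.
have := eval_neq0 (@basec_no_zero L).
have -> : eval_hom (basec L m n) R = (d%:~R : L).
  rewrite -[RHS]/((intr : {rmorphism int -> L}) d) eval_hom_comp.
  by apply: eq_eval_hom => i j k; rewrite basec_map.
have p0 : (p%:R : L) = 0.
  by rewrite -(rmorph_nat th) (pcharf0 (pchar_Fp pP)) rmorph0.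
by rewrite [d]intEsg intrM -pmulrn pd natrM p0 !mulr0 eqxx.
Qed.

End Resultant.

(** * Divisibility of a power of the resultant *)

Lemma dvdp_roots_exp (L : closedFieldType) (p q : {poly L}) :
  q != 0 -> (forall x, root q x -> root p x) -> exists M, q %| p ^+ M.
Proof.
move=> q0 H; have [r er] := closed_field_poly_normal q.
have lq : lead_coef q != 0 by rewrite lead_coef_eq0.
exists (size r); rewrite er dvdpZl //.
have : {in r, forall x, root p x}.
  by move=> x xr; apply: H; rewrite er rootZ // root_prod_XsubC.
elim: r {er} => [|x r IH] hr; first by rewrite big_nil dvd1p.
rewrite big_cons exprS dvdp_mul //.
  by rewrite dvdp_XsubCl hr ?mem_head.
by apply: IH => y yr; rewrite hr // inE yr orbT.
Qed.

Lemma prime_pow_factor (D : idomainType) (p x y : D) M :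
  prime_elt p -> x * y = p ^+ M -> x \is a GRing.unit \/ divides p x.
Proof.
move=> [p0 _ pP]; elim: M y => [|M IH] y e.
  by left; apply/unitrP; exists y; rewrite mulrC e.
have /pP[] : divides p (x * y) by exists (p ^+ M); rewrite e exprSr.
  by right.
case=> c ec; apply: (IH c); apply: (mulIf p0).
by rewrite -mulrA -ec e exprSr.
Qed.

Lemma unit_mpoly_int N (u : {mpoly int[N]}) :
  u \is a GRing.unit -> u = 1 \/ u = -1.
Proof.
move=> /unitrP[v [vu _]]; have /andP[/eqP eu] := mpoly_intro_unit vu.
rewrite -[_ \in _]/(_ \is a GRing.unit) unit_intE.
by case/orP=> /eqP h; [left|right]; rewrite eu h ?rmorphN rmorph1.
Qed.

Section Resultant.
Variables m n : nat.
Hypothesis (m0 : (0 < m)%N) (n0 : (0 < n)%N).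
Local Notation ZC := {mpoly int[#|cidx 3 m n|]}.
Local Notation coeffs A := ('I_3 -> 'I_m.+1 -> 'I_n.+1 -> A).
Variable R : ZC.
Hypothesis hR : isdet (sylc (@ucoef m n)) R.
Variable Res : ZC.
Hypothesis hRes : is_biresultant Res.

Lemma res_zero (L : closedFieldType) (a : coeffs L) :
  eval_hom a Res = 0 <-> has_biproj_zero (fun i => bipoly (a i)).
Proof.
have [_ H] := hRes; apply: (H L L idfun a) => z.
exists ('X - z%:P); first by rewrite monic_neq0 // monicXsubC.
by rewrite map_polyE map_id /= polyseqK root_XsubC.
Qed.

Lemma det_divides_pow : exists M A, A * R = Res ^+ M.
Proof.
pose a i j k : {poly ZC} := (ucoef i j k)%:P + basec ZC m n i j k *: 'X.
have [q hq qmon] : exists2 q, eqpm (eval_hom a R) q & q \is monic.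
  apply: (isdet_pencil (isdet_basec m0 n0 hR ZC) (M := sylc (@ucoef m n))).
  apply: eq_isdet (isdet_eval hR a) => y x; rewrite /sylc /syl /toep /extend.
  by do 2 (case: ifP => _; last by rewrite scale0r addr0).
have [L [th th_inj]] := exists_closed_extension #|cidx 3 m n|.
have th_eval F z : (map_poly th (eval_hom a F)).[z] =
    eval_hom (fun i j k => th (ucoef i j k) + basec L m n i j k * z) F.
  rewrite (eval_hom_comp (map_poly th)) -[_.[z]]/(horner_eval z _) eval_hom_comp.
  apply: eq_eval_hom => i j k.
  rewrite /a /= rmorphD /= map_polyC map_polyZ map_polyX /horner_eval.
  by rewrite hornerD hornerC hornerZ hornerX basec_map.
have qL0 : map_poly th q != 0 by rewrite monic_neq0 // monic_map.
have [M dv] : exists M, map_poly th q %| (map_poly th (eval_hom a Res)) ^+ M.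
  apply: dvdp_roots_exp => // z /rootP hz; apply/rootP; rewrite th_eval.
  apply/res_zero/(isdet_syl0_zero m0 n0).
  have <- : eval_hom (fun i j k => th (ucoef i j k) + basec L m n i j k * z) R = 0.
    rewrite -th_eval; case: hq => ->; rewrite ?rmorphN ?hornerN hz //.
    by rewrite oppr0.
  exact: isdet_eval.
exists M.
pose P := eval_hom a Res ^+ M.
(* Divisibility is known over L. As q is monic, the division can be done over Z[c]; its remainder is
   smaller than q and divisible by q over L, hence zero. Setting z = 0 afterwards recovers R and
   Res. *)
have e := Pdiv.RingMonic.rdivp_eq qmon P.
have r0 : Pdiv.CommonRing.rmodp P q = 0.
  apply: (map_inj_poly th_inj (rmorph0 th)); rewrite rmorph0.
  set r := Pdiv.CommonRing.rmodp P q in e *.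
  have dr : map_poly th q %| map_poly th r.
    have := congr1 (map_poly th) e; rewrite rmorphD rmorphM /= => e'.
    rewrite -(dvdp_addr _ (dvdp_mull (map_poly th (Pdiv.CommonRing.rdivp P q)) (dvdpp _))).
    by rewrite -e' rmorphXn.
  apply/eqP; apply: contraTT dr => rn0; rewrite gtNdvdp //.
  rewrite !size_map_inj_poly ?rmorph0 //.
  by apply: Pdiv.CommonRing.ltn_rmodpN0; rewrite monic_neq0.
rewrite r0 addr0 in e.
have ev0 F : (eval_hom a F).[0] = F.
  rewrite -[_.[0]]/(horner_eval 0 _) eval_hom_comp -[RHS]eval_hom_ucoef.
  apply: eq_eval_hom => i j k.
  by rewrite /a /= /horner_eval hornerD hornerC hornerZ hornerX mulr0 addr0.
have := congr1 (fun p => p.[0]) e; rewrite hornerM horner_exp ev0 => eM.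
have q0 : eqpm R q.[0] by rewrite -{1}(ev0 R); case: hq => ->; rewrite ?hornerN; [left|right].
case: q0 => q0; first by exists (Pdiv.CommonRing.rdivp P q).[0]; rewrite q0 eM.
by exists (- (Pdiv.CommonRing.rdivp P q).[0]); rewrite q0 mulrNN eM.
Qed.

End Resultant.

(** * A one-parameter specialization with 2mn known roots of the resultant *)

Definition hom_eval (F : fieldType) d (p : {poly F}) (s u : F) : F :=
  \sum_(j < d.+1) p`_j * (s ^+ j * u ^+ (d - j)).

Lemma hom_eval1 (F : fieldType) d (p : {poly F}) s : (size p <= d.+1)%N ->
  hom_eval d p s 1 = p.[s].
Proof.
move=> sp; rewrite (horner_coef_wide _ sp); apply: eq_bigr => j _.
by rewrite expr1n mulr1.
Qed.

(** The homogenization of a monic polynomial of degree exactly d reduces to s^d at u = 0, so it has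
    no zero at infinity. *)
Lemma hom_eval_zero (F : fieldType) d (p : {poly F}) s u :
  (0 < d)%N -> p \is monic -> size p = d.+1 -> (s, u) != (0, 0) ->
  hom_eval d p s u = 0 -> u != 0 /\ root p (s / u).
Proof.
move=> d0 pm sp; have [->|u0] := eqVneq u 0 => su.
  rewrite /hom_eval big_ord_recr /= subnn mulr1 big1 ?add0r => [|j _].
    have -> : p`_d = 1 by move/monicP: pm; rewrite lead_coefE sp.
    move/eqP; rewrite mul1r expf_eq0 d0 /= => /eqP s0.
    by move: su; rewrite s0 eqxx.
  by rewrite expr0n subn_eq0 leqNgt ltn_ord !mulr0.
move=> h; split=> //; apply/rootP.
have /eqP : u ^+ d * p.[s / u] = 0.
  rewrite -[RHS]h (horner_coef_wide (n := d.+1)) ?sp // big_distrr.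
  apply: eq_bigr => j _; rewrite [LHS]mulrCA; congr (p`_j * _).
  rewrite exprMn exprVn mulrCA; congr (_ * _).
  have jd : (j <= d)%N by rewrite -ltnS.
  by rewrite -{1}(subnK jd) exprD mulfK // expf_neq0.
by rewrite mulf_eq0 expf_eq0 (negbTE u0) andbF => /eqP.
Qed.

Definition natpoly (r : seq nat) : {poly algC} := \prod_(i <- r) ('X - (i%:R)%:P).

Lemma size_natpoly r : size (natpoly r) = (size r).+1.
Proof. by rewrite /natpoly size_prod_XsubC. Qed.

Lemma root_natpoly r x : root (natpoly r) x -> exists2 i, i \in r & x = i%:R.
Proof.
by rewrite /natpoly -(big_map _ predT (fun z => 'X - z%:P)) root_prod_XsubC => /mapP.
Qed.

Lemma natpoly_root r i : i \in r -> (natpoly r).[i%:R] = 0.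
Proof.
move=> ir; apply/rootP; rewrite /natpoly -(big_map _ predT (fun z => 'X - z%:P)).
by rewrite root_prod_XsubC; apply: map_f.
Qed.

Section Specialization.
Variables m n : nat.
Hypothesis (m0 : (0 < m)%N) (n0 : (0 < n)%N).
Local Notation ZC := {mpoly int[#|cidx 3 m n|]}.

(* Two products of linear forms, meeting in 2mn distinct points (x, z), and a
   pencil whose member through (x, z) has the parameter x + 2mz. *)
Definition specc (i : 'I_3) (j : 'I_m.+1) (k : 'I_n.+1) : {poly algC} :=
  match val i with
  | 0 => ((natpoly (iota 0 m))`_j * (natpoly (iota 0 n))`_k)%:P
  | 1 => ((natpoly (iota m m))`_j * (natpoly (iota n n))`_k)%:P
  | _ => (monoc algC (inord 1) ord0 j k + (2 * m)%:R * monoc algC ord0 (inord 1) j k)%:P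
         - monoc algC ord0 ord0 j k *: 'X
  end.

Lemma meval_specc y i s u t v :
  (bipoly (fun j k => (specc i j k).[y])).@[tnth [tuple s; u; t; v]] =
  match val i with
  | 0 => hom_eval m (natpoly (iota 0 m)) s u * hom_eval n (natpoly (iota 0 n)) t v
  | 1 => hom_eval m (natpoly (iota m m)) s u * hom_eval n (natpoly (iota n n)) t v
  | _ => s * u ^+ m.-1 * v ^+ n + (2 * m)%:R * (u ^+ m * (t * v ^+ n.-1)) - y * (u ^+ m * v ^+ n)
  end.
Proof.
have prodE (p q : {poly algC}) :
   \sum_(j < m.+1) \sum_(k < n.+1) (p`_j * q`_k)%:P.[y] * (s ^+ j * u ^+ (m - j) * (t ^+ k * v ^+ (n - k)))
     = hom_eval m p s u * hom_eval n q t v.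
  rewrite /hom_eval big_distrl; apply: eq_bigr => j _ /=.
  by rewrite big_distrr; apply: eq_bigr => k _ /=; rewrite hornerC mulrACA.
rewrite meval_bipoly /specc; case: (val i) => [|[|_]]; [exact: prodE|exact: prodE|].
under eq_bigr do under eq_bigr do rewrite hornerD hornerN hornerC hornerZ hornerX mulrBl mulrDl -!mulrA.
under eq_bigr do rewrite sumrB big_split /= -!big_distrr /=.
rewrite sumrB big_split /= -!big_distrr /=.
rewrite !sum_monoc /= !inordK ?ltnS // !expr0 !expr1 !subn0 !subn1 !mul1r.
by rewrite !mulrA.
Qed.

Lemma meval_specc0 x z i :
  (x \in iota 0 m) && (z \in iota n n) || (x \in iota m m) && (z \in iota 0 n) ->
  (bipoly (fun j k => (specc i j k).[(x + 2 * m * z)%:R])).@[tnth [tuple x%:R; 1; z%:R; 1]] = 0.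
Proof.
move=> h; rewrite meval_specc; case: (val i) => [|[|_]].
- rewrite !hom_eval1 ?size_natpoly ?size_iota //.
  by case/orP: h => /andP[h1 h2]; rewrite ?(natpoly_root h1) ?(natpoly_root h2) ?mul0r ?mulr0.
- rewrite !hom_eval1 ?size_natpoly ?size_iota //.
  by case/orP: h => /andP[h1 h2]; rewrite ?(natpoly_root h1) ?(natpoly_root h2) ?mul0r ?mulr0.
- by rewrite !expr1n natrD natrM; ring.
Qed.

Lemma specc_zero x z :
  (x \in iota 0 m) && (z \in iota n n) || (x \in iota m m) && (z \in iota 0 n) ->
  has_biproj_zero (fun i => bipoly (fun j k => (specc i j k).[(x + 2 * m * z)%:R])).
Proof.
move=> h; exists x%:R, 1, z%:R, 1; split=> [||i]; last exact: meval_specc0.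
- by rewrite xpair_eqE oner_eq0 andbF.
- by rewrite xpair_eqE oner_eq0 andbF.
Qed.

(** A common zero would lie on the first two products at natural coordinates x, z and force x + 2mz
    = -1, impossible in characteristic 0. This keeps the specialized determinant nonzero. *)
Lemma specc_no_zero :
  ~ has_biproj_zero (fun i => bipoly (fun j k => (specc i j k).[-1])).
Proof.
move=> [s [u [t [v [su tv H]]]]].
have := H (inord 0); have := H (inord 1); have := H (inord 2).
rewrite !meval_specc /= !inordK //= => h2 h1 h0.
have npm a d : natpoly (iota a d) \is monic by rewrite /natpoly rpred_prod // => i _; apply: monicXsubC.
have sz a d : size (natpoly (iota a d)) = d.+1 by rewrite size_natpoly size_iota.
suff [x [z [u0 v0 eu ev]]] : exists x z : nat, [/\ u != 0, v != 0, s / u = x%:R & t / v = z%:R].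
  move: h2; have -> : s = x%:R * u by rewrite -eu divfK.
  have -> : t = z%:R * v by rewrite -ev divfK.
  have um : u ^+ m = u * u ^+ m.-1 by rewrite -exprS prednK.
  have vn : v ^+ n = v * v ^+ n.-1 by rewrite -exprS prednK.
  have -> : x%:R * u * u ^+ m.-1 * v ^+ n + (2 * m)%:R * (u ^+ m * (z%:R * v * v ^+ n.-1))
      - -1 * (u ^+ m * v ^+ n) = (x + 2 * m * z + 1)%:R * (u ^+ m * v ^+ n).
    by rewrite um vn !natrD !natrM; ring.
  move/eqP; rewrite mulf_eq0 pnatr_eq0 addn1 /= mulf_eq0 !expf_eq0.
  by rewrite (negbTE u0) (negbTE v0) !andbF.
move: h0 h1 => /eqP; rewrite mulf_eq0 => /orP[] /eqP h0 /eqP; rewrite mulf_eq0 => /orP[] /eqP h1.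
- have [u0 /root_natpoly[x xi e]] := hom_eval_zero m0 (npm _ _) (sz _ _) su h0.
  have [_ /root_natpoly[x' xi' e']] := hom_eval_zero m0 (npm _ _) (sz _ _) su h1.
  move: e' xi xi'; rewrite e => /eqP; rewrite eqr_nat => /eqP ->.
  by rewrite !mem_iota add0n => /andP[_ l1] /andP[l2 _]; rewrite leqNgt l1 in l2.
- have [u0 /root_natpoly[x xi e]] := hom_eval_zero m0 (npm _ _) (sz _ _) su h0.
  have [v0 /root_natpoly[z zi e']] := hom_eval_zero n0 (npm _ _) (sz _ _) tv h1.
  by exists x, z.
- have [u0 /root_natpoly[x xi e]] := hom_eval_zero m0 (npm _ _) (sz _ _) su h1.
  have [v0 /root_natpoly[z zi e']] := hom_eval_zero n0 (npm _ _) (sz _ _) tv h0.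
  by exists x, z.
- have [u0 /root_natpoly[x xi e]] := hom_eval_zero n0 (npm _ _) (sz _ _) tv h0.
  have [_ /root_natpoly[x' xi' e']] := hom_eval_zero n0 (npm _ _) (sz _ _) tv h1.
  move: e' xi xi'; rewrite e => /eqP; rewrite eqr_nat => /eqP ->.
  by rewrite !mem_iota add0n => /andP[_ l1] /andP[l2 _]; rewrite leqNgt l1 in l2.
Qed.

Definition spec_points : seq (nat * nat) :=
  [seq (x, z) | x <- iota 0 m, z <- iota n n] ++ [seq (x, z) | x <- iota m m, z <- iota 0 n].

Definition spec_roots : seq algC := [seq (p.1 + 2 * m * p.2)%:R | p <- spec_points].

Lemma mem_spec_points p : p \in spec_points ->
  (p.1 \in iota 0 m) && (p.2 \in iota n n) || (p.1 \in iota m m) && (p.2 \in iota 0 n).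
Proof.
rewrite mem_cat => /orP[] /allpairsP[[x z] [/= h1 h2 ->]] /=; by rewrite h1 h2 ?orbT.
Qed.

Lemma size_spec_roots : size spec_roots = (2 * m * n)%N.
Proof. by rewrite size_map size_cat !size_allpairs !size_iota -mulnA mul2n -addnn. Qed.

(** Since x < 2m, the parameter x + 2mz determines x and z as remainder and quotient by 2m; this is
    the reason for the factor 2m in [specc]. *)
Lemma uniq_spec_roots : uniq spec_roots.
Proof.
rewrite map_inj_in_uniq; last first.
  move=> [x z] [x' z'] hp hp' /= /eqP; rewrite eqr_nat => /eqP e.
  have lt q : q \in spec_points -> (q.1 < 2 * m)%N.
    by move=> /mem_spec_points; rewrite !mem_iota; lia.
  have l1 := lt _ hp; have l2 := lt _ hp'; rewrite /= in l1 l2.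
  have ez : z = z'.
    have := congr1 (fun k => k %/ (2 * m))%N e.
    by rewrite !(mulnC (2 * m)%N) ![(_ + _ * _)%N]addnC !divnMDl ?(divn_small l1) ?(divn_small l2) ?addn0 // muln_gt0.
  by move: e; rewrite ez => /addIn ->.
rewrite cat_uniq !allpairs_uniq ?iota_uniq //=; try by move=> [? ?] [? ?].
rewrite andbT; apply/hasPn => p /allpairsP[[x z] [/= h1 h2 ->]].
apply/negP => /allpairsP[[x' z'] [/= h1' h2' []]] ex ez.
by move: h1 h1'; rewrite ex !mem_iota; lia.
Qed.

End Specialization.

(** * The resultant divides the Sylvester determinant exactly once *)

Section Final.
Variables m n : nat.
Hypothesis (m0 : (0 < m)%N) (n0 : (0 < n)%N).
Local Notation ZC := {mpoly int[#|cidx 3 m n|]}.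
Variable R : ZC.
Hypothesis hR : isdet (sylc (@ucoef m n)) R.
Variable Res : ZC.
Hypothesis hRes : is_biresultant Res.

Let spec : {rmorphism ZC -> {poly algC}} := eval_hom (@specc m n).

Lemma horner_spec F y : (spec F).[y] = eval_hom (fun i j k => (specc i j k).[y]) F.
Proof. by rewrite -[_.[y]]/(horner_eval y _) eval_hom_comp. Qed.

Lemma spec_det_neq0 : spec R != 0.
Proof.
have : (spec R).[-1] != 0.
  rewrite horner_spec; apply: (eval_neq0 m0 n0 hR); exact: specc_no_zero.
by apply: contraNneq => ->; rewrite horner0.
Qed.

(** Only the 2mn columns coming from the third polynomial involve the parameter, each with degree at
    most 1. *)
Lemma size_spec_det : (size (spec R) <= (2 * m * n).+1)%N.
Proof.
have sy := isdet_eval hR (@specc m n).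
have -> : (2 * m * n = \sum_(x : 'I_3 * ('I_(2 * m) * 'I_n)) (x.1 == 2 :> nat))%N.
  rewrite -(pair_bigA _ (fun (i : 'I_3) (x : 'I_(2 * m) * 'I_n) => (i == 2 :> nat) : nat)) /=.
  under eq_bigr do rewrite sum_nat_const.
  by rewrite !big_ord_recl big_ord0 /= card_prod !card_ord; lia.
apply: (isdet_size sy) => y [i x].
rewrite /sylc /syl /toep; case: ifP => _; last by rewrite size_poly0.
rewrite /extend; case: ifP => _; last by rewrite size_poly0.
rewrite /specc /=; case: i => [[|[|[|//]]] hi] /=; try exact: size_polyC_leq1.
apply: leq_trans (size_polyD _ _) _; rewrite geq_max size_polyN.
rewrite (leq_trans (size_polyC_leq1 _)) //.
by apply: leq_trans (size_scale_leq _ _) _; rewrite size_polyX.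
Qed.

Lemma spec_res_root y : y \in spec_roots m n -> root (spec Res) y.
Proof.
case/mapP => -[x z] /mem_spec_points h ->; apply/rootP; rewrite horner_spec.
by apply/(res_zero hRes)/specc_zero.
Qed.

Lemma size_spec_res : spec Res != 0 -> (2 * m * n < size (spec Res))%N.
Proof.
move=> P0; rewrite -(size_spec_roots m n); apply: max_poly_roots => //.
  by apply/allP => y; apply: spec_res_root.
exact: uniq_spec_roots.
Qed.

Theorem sylvester_resultant : eqpm R Res.
Proof.
have prRes : prime_elt Res.
  by apply: irreducible_prime; [exact: factorial_mpoly | case: hRes].
have mn0 : (0 < 2 * m * n)%N by rewrite !muln_gt0 m0 n0.
have [M [A e]] := det_divides_pow m0 n0 hR hRes.
have := prime_pow_factor prRes (etrans (mulrC R A) e).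
case=> [Ru|[R1 eR]].
  (* R is not a unit: it vanishes at the parameter of (x, z) = (0, n), one of the 2mn intersection
     points. *)
  have /eqP : (spec R).[(0 + 2 * m * n)%:R] == 0.
    rewrite horner_spec; apply/eqP.
    apply: (syl_common_zero m0 n0 (isdet_eval hR _) (s := 0%:R) (t := n%:R)) => i.
    have := @meval_specc0 m n m0 n0 0 n i; rewrite meval_bipoly => h; rewrite -[RHS]h.
      by apply: eq_bigr => j _; apply: eq_bigr => k _; rewrite !expr1n !mulr1 mulrA.
    by rewrite !mem_iota leqnn add0n m0 -[ltnLHS]addn0 ltn_add2l n0.
  have [R' [_ RR]] := unitrP Ru.
  have := congr1 (fun F => (spec F).[(0 + 2 * m * n)%:R]) RR.
  rewrite rmorphM hornerM rmorph1 hornerC => + h0; rewrite h0 mul0r => /eqP.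
  by rewrite eq_sym oner_eq0.
have [r0 rU _] := prRes.
(* With one factor Res cancelled, the cofactor [R1] divides a smaller power, so it is a unit, hence
   +-1, or again divisible by Res. *)
have e1 : R1 * A = Res ^+ M.-1.
  case: M e => [|M] e.
    by case/negP: rU; apply/unitrP; exists (A * R1); rewrite (mulrC Res) -mulrA -eR e.
  by apply: (mulIf r0); rewrite -exprSr -e eR mulrA (mulrC A).
have := prime_pow_factor prRes e1.
case=> [/unit_mpoly_int[]|[S eS]].
- by move=> r1; left; rewrite eR r1 mul1r.
- by move=> r1; right; rewrite eR r1 mulN1r.
(* If Res^2 divided R, the specialized determinant would have degree at least 4mn, above the bound
   2mn. *)
have := spec_det_neq0; have := size_spec_det.
rewrite eR eS !rmorphM /= => sz; rewrite !mulf_eq0 !negb_or => /andP[/andP[S0 P0] _].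
have sP := size_spec_res P0.
move: sz; rewrite !size_mul ?mulf_neq0 //.
have : (0 < size (spec S))%N by rewrite size_poly_gt0.
by move: (size (spec S)) (size (spec Res)) sP mn0; lia.
Qed.

End Final.

(** * The Koszul complex *)

Lemma isdet_diag (A : comNzRingType) (I J : finType) (M : I -> J -> A) d k :
  isdet M d ->
  isdet (fun (r : 'I_k * I) (q : 'I_k * J) => (r.1 == q.1)%:R * M r.2 q.2) (d ^+ k).
Proof.
move=> hM; have cIJ : #|I| = #|J|.
  case: hM => k' [e [f [be bf _]]]; by rewrite -(bij_ord_card be) -(bij_ord_card bf).
elim: k => [|k IH].
  have [|d' hd'] := @isdet_exists A ('I_0 * I)%type ('I_0 * J)%type
     (fun r q => (r.1 == q.1)%:R * M r.2 q.2); first by rewrite !card_prod !card_ord.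
  apply: isdet_eqpm (hd') _; apply: eqpm_sym; case: hd' => k' [e [f [be _ h]]].
  have k0 : k' = 0%N by rewrite (bij_ord_card be) card_prod card_ord.
  by subst k'; rewrite det_mx00 in h.
rewrite exprS.
have bij (I' : finType) : bijective (sum_case (fun x : I' => (ord0 : 'I_k.+1, x))
    (fun q : 'I_k * I' => (lift ord0 q.1, q.2))).
  apply: sum_case_bij.
  - by move=> x y [].
  - move=> [a x] [b y] /= e; congr pair; last exact: (congr1 snd e).
    by apply: (@lift_inj _ ord0); exact: (congr1 fst e).
  - by move=> x [a y] /= e; have := congr1 (fun p => val p.1) e.
  - by rewrite !card_prod !card_ord mulSn.
apply: (isdet_block (bij I) (bij J)).
- by move=> i j; rewrite /= mul0r.
- by apply: eq_isdet hM => i j /=; rewrite mul1r.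
- by apply: eq_isdet IH => i j /=; rewrite (inj_eq lift_inj).
Qed.

Lemma sub_case_bij (I : finType) (p : pred I) :
  bijective (sum_case (val : {x | p x} -> I) (val : {x | ~~ p x} -> I)).
Proof.
apply: sum_case_bij; [exact: val_inj|exact: val_inj| |].
  by move=> [a pa] [b pb] /= ab; rewrite ab (negbTE pb) in pa.
by rewrite !card_sig -(cardC p).
Qed.

Section Bivariate.
Variable A : comNzRingType.

Lemma coef_monomial_sum a b (q : 'I_a * 'I_b -> A) k1 k2 :
  (\sum_y (q y *: 'X^(y.2)) *: 'X^(y.1))`_k1`_k2 =
  \sum_y q y * ((k1 == y.1) && (k2 == y.2))%:R.
Proof.
rewrite !coef_sum; apply: eq_bigr => y _; rewrite coefZ coefXn.
by case: (k1 == _); rewrite ?mulr1 ?mulr0 ?coef0 ?mulr0 // coefZ coefXn.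
Qed.

Lemma coef_bivarM_sum m n c a b (q : 'I_a * 'I_b -> A) z1 z2 :
  (forall j k, (m < j)%N || (n < k)%N -> c j k = 0) ->
  (bivar m n c * \sum_y (q y *: 'X^(y.2)) *: 'X^(y.1))`_z1`_z2 =
    \sum_(y : 'I_a * 'I_b) toep c z1 z2 y.1 y.2 * q y.
Proof.
move=> supp; rewrite big_distrr !coef_sum /=; apply: eq_bigr => y _.
rewrite mulrC -scalerAl coefZ coefXnM /toep.
case: ltnP => [lt|le] /=; first by rewrite mulr0 coef0 mul0r.
rewrite -scalerAl coefZ coefXnM; case: ltnP => [lt|le'] /=; first by rewrite mulr0 mul0r.
by rewrite coef_bivar // mulrC.
Qed.

Lemma bivarM_monomial m n (c : nat -> nat -> A) (x : 'I_m * 'I_n) :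
  (forall j k, (m < j)%N || (n < k)%N -> c j k = 0) ->
  bivar m n c * (('X^(x.2)) *: 'X^(x.1)) =
  \sum_(y : 'I_(2 * m) * 'I_(2 * n)) (toep c y.1 y.2 x.1 x.2 *: 'X^(y.2)) *: 'X^(y.1).
Proof.
move=> supp; apply/polyP => k1; apply/polyP => k2; rewrite coef_monomial_sum.
have -> : (bivar m n c * ('X^(x.2) *: 'X^(x.1)))`_k1`_k2 = toep c k1 k2 x.1 x.2.
  rewrite mulrC -scalerAl coefZ coefXnM /toep.
  case: ltnP => [lt|le] /=; first by rewrite andbF.
  rewrite andbT coefXnM; case: ltnP => [lt|le'] /=; first by rewrite coef0.
  by rewrite coef_bivar.
have [/andP[l1 l2]|out] := boolP ((k1 < 2 * m) && (k2 < 2 * n))%N.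
  rewrite (bigD1 (Ordinal l1, Ordinal l2)) //= !eqxx mulr1 big1 ?addr0 // => -[y1 y2] ne.
  case: andP => [[/eqP e1 /eqP e2]|]; last by rewrite mulr0.
  by case/eqP: ne; congr pair; apply: val_inj.
rewrite big1 => [|y _]; last first.
  case: andP => [[/eqP e1 /eqP e2]|]; last by rewrite mulr0.
  by rewrite e1 e2 !ltn_ord in out.
rewrite /toep; case: ifP => // /andP[le1 le2]; rewrite supp //.
case: x le1 le2 => [[x1 hx1] [x2 hx2]] /= le1 le2.
by move: out hx1 hx2 le1 le2; lia.
Qed.

(** Both sides are the same coefficient of the product of the two polynomials with a monomial. This
    commutativity is what makes D vanish on the Koszul syzygies. *)
Lemma toep_comm m n (c c' : nat -> nat -> A) (z1 z2 : nat) (x : 'I_m * 'I_n) :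
  (forall j k, (m < j)%N || (n < k)%N -> c j k = 0) ->
  (forall j k, (m < j)%N || (n < k)%N -> c' j k = 0) ->
  \sum_(y : 'I_(2 * m) * 'I_(2 * n)) toep c z1 z2 y.1 y.2 * toep c' y.1 y.2 x.1 x.2 =
  \sum_(y : 'I_(2 * m) * 'I_(2 * n)) toep c' z1 z2 y.1 y.2 * toep c y.1 y.2 x.1 x.2.
Proof.
move=> sc sc'.
rewrite -(coef_bivarM_sum _ _ _ sc) -(coef_bivarM_sum _ _ _ sc').
by rewrite -!bivarM_monomial // mulrCA.
Qed.
End Bivariate.

Definition ordshift k p q (h : (k + p <= q)%N) (i : 'I_p) : 'I_q :=
  widen_ord h (rshift k i).

Lemma split_fst_bij a p r q (h1 : (0 + p <= q)%N) (h2 : (p + r <= q)%N) : (q <= p + r)%N ->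
  bijective (sum_case (fun x : 'I_p * 'I_a => (ordshift h1 x.1, x.2))
                      (fun x : 'I_r * 'I_a => (ordshift h2 x.1, x.2))).
Proof.
move=> le; apply: sum_case_bij.
- move=> [x1 x2] [y1 y2] /= e; congr pair; last exact: (congr1 snd e).
  by apply: val_inj; have := congr1 (fun p => val p.1) e.
- move=> [x1 x2] [y1 y2] /= e; congr pair; last exact: (congr1 snd e).
  by apply: val_inj; have := congr1 (fun p => val p.1) e => /= /addnI.
- move=> [x1 x2] [y1 y2] /= e; have := congr1 (fun p => val p.1) e => /=.
  by have := ltn_ord x1; lia.
- by rewrite !card_prod !card_ord; nia.
Qed.

Lemma split_snd_bij a p r q (h1 : (0 + p <= q)%N) (h2 : (p + r <= q)%N) : (q <= p + r)%N ->
  bijective (sum_case (fun x : 'I_a * 'I_p => (x.1, ordshift h1 x.2))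
                      (fun x : 'I_a * 'I_r => (x.1, ordshift h2 x.2))).
Proof.
move=> le; apply: sum_case_bij.
- move=> [x1 x2] [y1 y2] /= e; congr pair; first exact: (congr1 fst e).
  by apply: val_inj; have := congr1 (fun p => val p.2) e.
- move=> [x1 x2] [y1 y2] /= e; congr pair; first exact: (congr1 fst e).
  by apply: val_inj; have := congr1 (fun p => val p.2) e => /= /addnI.
- move=> [x1 x2] [y1 y2] /= e; have := congr1 (fun p => val p.2) e => /=.
  by have := ltn_ord x2; lia.
- by rewrite !card_prod !card_ord; nia.
Qed.

Lemma sum_id_bij (I J : finType) : bijective (sum_case (@inl I J) (@inr I J)).
Proof. by apply: inj_card_bij => // -[x|x] [y|y]. Qed.

Lemma sum_swap_bij (I J : finType) : bijective (sum_case (@inr J I) (@inl J I)).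
Proof.
apply: sum_case_bij => //; try by move=> x y [].
by rewrite card_sum addnC.
Qed.

Lemma sum_case_swap (I1 I2 I : finType) (g1 : I1 -> I) (g2 : I2 -> I) :
  bijective (sum_case g1 g2) -> bijective (sum_case g2 g1).
Proof.
move=> b; apply: (@eq_bij _ _ (sum_case g1 g2 \o sum_case (@inr I1 I2) (@inl I1 I2))).
  exact: bij_comp (sum_swap_bij _ _).
by case.
Qed.

Lemma toep_shift1 (A : nmodType) c k y1 y2 x1 x2 :
  toep c (k + y1) y2 (k + x1) x2 = toep c y1 y2 x1 x2 :> A.
Proof. by rewrite /toep leq_add2l subnDl. Qed.

Lemma toep_shift2 (A : nmodType) c k y1 y2 x1 x2 :
  toep c y1 (k + y2) x1 (k + x2) = toep c y1 y2 x1 x2 :> A.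
Proof. by rewrite /toep leq_add2l subnDl. Qed.

Definition i30 : 'I_3 := @Ordinal 3 0 isT.
Definition i31 : 'I_3 := @Ordinal 3 1 isT.
Definition i32 : 'I_3 := @Ordinal 3 2 isT.
Definition widen34 : 'I_3 -> 'I_4 := widen_ord (leqnSn 3).

(** The nine products x_j x_i with j <= i, other than x_4^2; they correspond to [Gamma0]. *)
Definition ordered (p : 'I_3 * 'I_4) : bool := (p.1 <= p.2)%N.

Lemma card_ordered : #|{: {p | ordered p}}| = 9%N.
Proof.
rewrite card_sig.
rewrite -sum1_card -(pair_big_dep xpredT (fun i j => ordered (i, j)) (fun _ _ => 1%N)) /=.
rewrite /ordered /= !big_ord_recl big_ord0.
by rewrite !(big_mkcond (fun j : 'I_4 => (_ <= j)%N)) !big_ord_recl !big_ord0.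
Qed.

Section Koszul.
Variables (A : comNzRingType) (m n : nat) (c : 'I_4 -> nat -> nat -> A).
Hypothesis supp : forall i j k, (m < j)%N || (n < k)%N -> c i j k = 0.
Local Notation c3 i := (c (widen34 i)).
Local Notation B := ('I_m * 'I_n)%type.
Local Notation C := ('I_(2 * m) * 'I_(2 * n))%type.
Local Notation E := ('I_(3 * m) * 'I_(3 * n))%type.
Local Notation T i y x := (toep (c i) y.1 y.2 x.1 x.2).

(* S_{m-1,n-1}^4 -> S_{2m-1,2n-1} and the sum of three copies of it. *)
Definition phi_mx (y : C) (q : 'I_4 * B) : A := T q.1 y q.2.
Definition phi3_mx (r : 'I_3 * C) (q : 'I_3 * ('I_4 * B)) : A :=
  (r.1 == q.1)%:R * phi_mx r.2 q.2.

(* S_{2m-1,2n-1}^3 -> S_{3m-1,3n-1}. *)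
Definition mul3_mx (z : E) (r : 'I_3 * C) : A := T (widen34 r.1) z r.2.

Definition msq_mx (z : E) (q : {p | ordered p} * B) : A :=
  \sum_(y : C) T (widen34 (val q.1).1) z y * T (val q.1).2 y q.2.

(* The diagonal blocks common to [(D, p)] and [p K]: their determinants cancel. *)
Definition corner_mx (y x : B) : A := toep (c3 i30) (m + y.1) (n + y.2) x.1 x.2.
Definition pair_mx (y : 'I_(2 * m) * 'I_n) (x : B + B) : A :=
  match x with
  | inl x => toep (c3 i30) y.1 (n + y.2) x.1 x.2
  | inr x => toep (c3 i31) y.1 (n + y.2) x.1 x.2
  end.

(** Column (j, i) goes to (i, j). The [inord] is only meaningful for i < 3, which holds when i <
    j. *)
Let swap (q : 'I_3 * ('I_4 * B)) : 'I_3 * ('I_4 * B) :=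
  (inord q.2.1, (widen34 q.1, q.2.2)).

(* The columns (j, i) with i < j of phi3 are replaced by Koszul syzygies. *)
Let syz_mx r q := phi3_mx r q - (if (q.2.1 < q.1)%N then phi3_mx r (swap q) else 0).

Let below (q : 'I_3 * ('I_4 * B)) := (q.2.1 < q.1)%N.

Lemma below_swap q : below q -> ~~ below (swap q).
Proof.
case: q => [[j hj] [[i hi] x]]; rewrite /below /swap /= => ij.
by rewrite inordK //= -?leqNgt; lia.
Qed.

(** The column operation is unipotent: it subtracts from columns with i < j only columns outside
    that set, so its matrix is block triangular with identity blocks. *)
Lemma isdet_syz P : isdet phi_mx P -> isdet syz_mx (P ^+ 3).
Proof.
move=> hP; have h3 := isdet_diag 3 hP.
pose Z q0 q : A := (q0 == q)%:R - (if below q then (q0 == swap q)%:R else 0).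
have hZ : isdet Z 1.
  rewrite -[1]mulr1; apply: (isdet_block (sub_case_bij below) (sub_case_bij below)).
  - move=> [i hi] [j hj]; rewrite /Z /= (negbTE hj) subr0.
    by case: eqP => // e; rewrite e (negbTE hj) in hi.
  - apply: eq_isdet (isdet1 A _) => -[i hi] [j hj]; rewrite /Z /= hj.
    rewrite -(inj_eq val_inj) /=; case: (i =P swap j) => [e|_]; last by rewrite subr0.
    by move: hi; rewrite e (negbTE (below_swap hj)).
  - apply: eq_isdet (isdet1 A _) => -[i hi] [j hj]; rewrite /Z /= (negbTE hj) subr0.
    by rewrite -(inj_eq val_inj).
rewrite -[P ^+ 3]mulr1; apply: eq_isdet (isdet_mul h3 hZ) => r q.
have pick f q' : \sum_j f j * (j == q')%:R = f q' :> A.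
  rewrite (bigD1 q') //= eqxx mulr1 big1 ?addr0 // => j /negbTE ->.
  by rewrite mulr0.
rewrite /Z; under eq_bigr do rewrite mulrBr.
rewrite sumrB (pick _ (phi3_mx r)) /syz_mx; congr (_ - _).
rewrite /below; case: ifP => _; first by rewrite (pick _ (phi3_mx r)).
by rewrite big1 // => j _; rewrite mulr0.
Qed.

Let h0m : (0 + m <= 2 * m)%N. Proof. by rewrite mul2n -addnn leq_addl. Qed.
Let h0n : (0 + n <= 2 * n)%N. Proof. by rewrite mul2n -addnn leq_addl. Qed.
Let hmm : (m + m <= 2 * m)%N. Proof. by rewrite mul2n -addnn. Qed.
Let hnn : (n + n <= 2 * n)%N. Proof. by rewrite mul2n -addnn. Qed.
Let h02m : (0 + 2 * m <= 3 * m)%N. Proof. by lia. Qed.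
Let h02n : (0 + 2 * n <= 3 * n)%N. Proof. by lia. Qed.
Let h2m : (2 * m + m <= 3 * m)%N. Proof. by lia. Qed.
Let h2n : (2 * n + n <= 3 * n)%N. Proof. by lia. Qed.

(** [Qi] and [Pi] split the monomials of the three summands. [Pi], the target of p, keeps t-degree
    >= n in the third summand, and t-degree >= n with s-degree >= m in the second: 3mn coordinates,
    as many as Koszul syzygies. In [Qi] the monomials of t-degree < n are set apart, being the
    source of Syl. *)
Let Qi := ('I_3 * ('I_(2 * m) * 'I_n) + ('I_(2 * m) * 'I_n + B))%type.
Let Pi := (B + 'I_(2 * m) * 'I_n)%type.

Let qmap (x : Qi) : 'I_3 * C :=
  match x with
  | inl x => (x.1, (x.2.1, ordshift h0n x.2.2))
  | inr (inl x) => (i30, (x.1, ordshift hnn x.2))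
  | inr (inr x) => (i31, (ordshift h0m x.1, ordshift hnn x.2))
  end.

Let pmap (x : Pi) : 'I_3 * C :=
  match x with
  | inl x => (i31, (ordshift hmm x.1, ordshift hnn x.2))
  | inr x => (i32, (x.1, ordshift hnn x.2))
  end.

Let kmap (x : B + (B + B)) : 'I_3 * ('I_4 * B) :=
  match x with
  | inl x => (i31, (widen34 i30, x))
  | inr (inl x) => (i32, (widen34 i30, x))
  | inr (inr x) => (i32, (widen34 i31, x))
  end.

Let omap (x : {p | ordered p} * B) : 'I_3 * ('I_4 * B) := ((val x.1).1, ((val x.1).2, x.2)).

Lemma qpmap_bij : bijective (sum_case qmap pmap).
Proof.
have ex (r r' : 'I_3 * C) : r = r' -> 
  [/\ r.1 = r'.1 :> nat, r.2.1 = r'.2.1 :> nat & r.2.2 = r'.2.2 :> nat] by move=> ->.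
apply: sum_case_bij.
- move=> [[i [a b]]|[[a b]|[a b]]] [[i' [a' b']]|[[a' b']|[a' b']]] /ex [] //= e1 e2 e3;
    try by (exfalso; move: (ltn_ord b) (ltn_ord b'); lia).
  + by congr (inl (_, (_, _))); apply: val_inj => //; move: e3; rewrite !add0n.
  + by congr (inr (inl (_, _))); apply: val_inj => //; move: e3 => /addnI.
  + by congr (inr (inr (_, _))); apply: val_inj => //; move: e3 => /addnI.
- move=> [[a b]|[a b]] [[a' b']|[a' b']] /ex [] //= e1 e2 e3.
  + by congr (inl (_, _)); apply: val_inj => //; [move: e2 => /addnI|move: e3 => /addnI].
  + by congr (inr (_, _)); apply: val_inj => //; move: e3 => /addnI.
- move=> [[i [a b]]|[[a b]|[a b]]] [[a' b']|[a' b']] /ex [] //= e1 e2 e3;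
    move: (ltn_ord a) (ltn_ord b) (ltn_ord a') (ltn_ord b'); lia.
- by rewrite !card_sum !card_prod !card_ord; nia.
Qed.

Lemma okmap_bij : bijective (sum_case omap kmap).
Proof.
apply: sum_case_bij.
- move=> [[[i j] hp] x] [[[i' j'] hp'] x'] [e1 e2 e3]; congr (_, _) => //.
  by apply: val_inj; rewrite /= e1 e2.
- move=> [x|[x|x]] [y|[y|y]] e; move: (congr1 (fun q => val q.1) e)
    (congr1 (fun q => val q.2.1) e) (congr1 (fun q => q.2.2) e) => //= _ _ -> //.
- by move=> [[[i j] hp] x] [y|[y|y]] e; move: (congr1 fst e) (congr1 (fun q => q.2.1) e) (hp);
    rewrite /ordered /= => -> ->.
- rewrite !card_prod !card_sum !card_prod card_ordered !card_ord.
  by nia.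
Qed.

Lemma sum_mul3_phi3 z j i x :
  \sum_r mul3_mx z r * phi3_mx r (j, (i, x)) = \sum_(y : C) T (widen34 j) z y * T i y x.
Proof.
rewrite -(pair_bigA _ (fun j' y => mul3_mx z (j', y) * phi3_mx (j', y) (j, (i, x)))) /=.
rewrite (bigD1 j) //= [X in _ + X]big1 ?addr0 => [|j' /negbTE jj].
  by apply: eq_bigr => y _; rewrite /phi3_mx /= eqxx mul1r.
by rewrite big1 // => y _; rewrite /phi3_mx /= jj mul0r mulr0.
Qed.

Theorem koszul_det P s r g1 g2 :
  isdet phi_mx P -> isdet msq_mx s -> isdet (syl (m := m) (n := n) (fun i => c3 i)) r ->
  isdet corner_mx g1 -> isdet pair_mx g2 ->
  eqpm (s * (g2 * g1)) (r * (g2 * g1) * P ^+ 3).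
Proof.
move=> hP hs hr h1 h2.
pose D (e : E + Pi) (q : 'I_3 * C) : A :=
  match e with inl z => mul3_mx z q | inr p => (pmap p == q)%:R end.
(* On rows of t-degree >= 2n and columns of t-degree >= n, columns of s-degree < m do not reach rows
   of s-degree >= 2m. This separates [corner_mx] from [pair_mx]. *)
have hG : isdet (fun (y : 'I_(3 * m) * 'I_n) (x : 'I_(2 * m) * 'I_n + B) =>
    mul3_mx (y.1, ordshift h2n y.2) (qmap (inr x))) (g1 * g2).
  have bc : bijective (sum_case (fun x : B => inl (ordshift hmm x.1, x.2))
     (fun x : B + B => match x with inl x => inl (ordshift h0m x.1, x.2) | inr x => inr x end :
         'I_(2 * m) * 'I_n + B)).
    pose pr (x : 'I_(2 * m) * 'I_n + B) : nat * nat := match x with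
      inl x => (val x.1, val x.2) | inr x => (val x.1, val x.2) end.
    apply: sum_case_bij.
    - move=> [a b] [a' b'] e; have := congr1 (fun x => (pr x).1) e; have := congr1 (fun x => (pr x).2) e.
      by rewrite /= => e2 /addnI e1; congr (_, _); apply: val_inj.
    - move=> [[a b]|x] [[a' b']|x'] e.
      + have := congr1 (fun x => (pr x).1) e; have := congr1 (fun x => (pr x).2) e.
        by rewrite /= => e2 e1; congr (inl (_, _)); apply: val_inj.
      + by have := congr1 (fun x => if x is inl _ then 0%N else 1%N) e.
      + by have := congr1 (fun x => if x is inl _ then 0%N else 1%N) e.
      + by congr inr; move: e => [].
    - move=> [a b] [[a' b']|x'] e; last first.
        by have := congr1 (fun x => if x is inl _ then 0%N else 1%N) e.
      have := congr1 (fun x => (pr x).1) e => /=.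
      by have := ltn_ord a'; lia.
    - by rewrite !card_sum !card_prod !card_ord; nia.
  have l3m : (3 * m <= 2 * m + m)%N by lia.
  have br := sum_case_swap (split_fst_bij n h02m h2m l3m).
  apply: (isdet_block br bc).
  - move=> [a b] j; rewrite /mul3_mx /toep; case: ifP => // _; apply: supp.
    apply/orP; left; case: j => [[a' b']|[a' b']] /=; have := ltn_ord a'; lia.
  - apply: eq_isdet h1 => -[a b] [a' b']; rewrite /mul3_mx /corner_mx /=.
    have -> : (2 * m + a = m + (m + a))%N by lia.
    have -> : (2 * n + b = n + (n + b))%N by lia.
    by rewrite toep_shift1 toep_shift2.
  - apply: eq_isdet h2 => -[a b] x; rewrite /mul3_mx /pair_mx.
    have e : (2 * n + b = n + (n + b))%N by lia.
    by case: x => [[a' b']|[a' b']]; rewrite /= e toep_shift2.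
(* Columns of t-degree < n only reach rows of t-degree < 2n, where they form Syl; the complementary
   block is [hG]. *)
have hQ : isdet (fun z q => mul3_mx z (qmap q)) (r * (g2 * g1)).
  rewrite (mulrC r) (mulrC g2).
  have l3n : (3 * n <= 2 * n + n)%N by lia.
  apply: (isdet_block (sum_case_swap (split_snd_bij (3 * m) h02n h2n l3n)) (sum_swap_bij _ _)).
  - move=> [a b] [i [a' b']]; rewrite /mul3_mx /toep /=; case: ifP => // _; apply: supp.
    by apply/orP; right; have := ltn_ord b'; lia.
  - exact: hG.
  - apply: eq_isdet hr => -[a b] [i [a' b']]; by rewrite /mul3_mx /syl /= !add0n.
(* The rows of p are zero on [Qi] and the identity on [Pi], so only D on [Qi] counts. *)
have hD : isdet D (r * (g2 * g1)).
  rewrite -[r * _]mul1r.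
  apply: (isdet_block (sum_swap_bij _ _) (sum_case_swap qpmap_bij)).
  - move=> p q /=; case: eqP => // e.
    by have := bij_inj qpmap_bij (_ : sum_case qmap pmap (inr p) = sum_case qmap pmap (inl q)) => /(_ e).
  - apply: eq_isdet (isdet1 A _) => p p' /=.
    have pi : injective pmap.
      by move=> x y e; have [] := bij_inj qpmap_bij (e : sum_case qmap pmap (inr x) = sum_case qmap pmap (inr y)).
    by rewrite (inj_eq pi).
  - exact: hQ.
have inord3 k : (k < 3)%N -> forall i : 'I_3, (i == inord k) = (val i == k).
  by move=> lk i; rewrite -val_eqE /= inordK.
(* The syzygy between x_1 and x_2 has no third component, and its second one gives [corner_mx]; the
   third components of the other two syzygies are multiples of x_1 and x_2 and give [pair_mx]. *)
have hPK : isdet (fun p k => syz_mx (pmap p) (kmap k)) (g2 * g1).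
  apply: (isdet_block (sum_swap_bij _ _) (sum_swap_bij _ _)).
  - by move=> y x; rewrite /syz_mx /phi3_mx /= inord3 //= !mul0r subr0.
  - apply: eq_isdet h2 => -[a b] [[a' b']|[a' b']]; rewrite /syz_mx /phi3_mx /= inord3 //=.
      by rewrite mul0r mul1r subr0.
    by rewrite mul0r mul1r subr0.
  - apply: eq_isdet h1 => -[a b] [a' b']; rewrite /syz_mx /phi3_mx /= inord3 //=.
    by rewrite mul0r mul1r subr0.
have hDS := isdet_mul hD (isdet_syz hP).
have DS z q : \sum_j D (inl z) j * syz_mx j q =
   \sum_(y : C) T (widen34 q.1) z y * T q.2.1 y q.2.2 -
   (if below q then \sum_(y : C) T (widen34 (swap q).1) z y * T (swap q).2.1 y (swap q).2.2 else 0).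
  rewrite /syz_mx -/(below q) /=; under eq_bigr do rewrite mulrBr.
  rewrite sumrB; congr (_ - _); first by case: (q) => j [i x]; apply: sum_mul3_phi3.
  case: ifP => _; first exact: sum_mul3_phi3.
  by rewrite big1 // => j _; rewrite mulr0.
apply: isdet_uniq hDS.
apply: (isdet_block (sum_id_bij _ _) okmap_bij).
- move=> z k; rewrite DS; have -> : below (kmap k) by case: k => [x|[x|x]].
  rewrite (toep_comm z.1 z.2 (kmap k).2.2 (@supp _) (@supp _)).
  apply/eqP; rewrite subr_eq0; apply/eqP.
  have e0 : inord 0 = i30 by apply: val_inj; rewrite /= inordK.
  have e1 : inord 1 = i31 by apply: val_inj; rewrite /= inordK.
  by case: k => [x|[x|x]]; rewrite /swap /= ?e0 ?e1.
- apply: eq_isdet hs => z q; rewrite DS (_ : below (omap q) = false) ?subr0 //.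
  by case: q => [[[j i] hp] x]; apply/negbTE; rewrite /below /= -leqNgt.
- apply: eq_isdet hPK => p k; rewrite (bigD1 (pmap p)) //= eqxx mul1r big1 ?addr0 // => q.
  by rewrite eq_sym => /negbTE ->; rewrite mul0r.
Qed.
End Koszul.

(** * Matrices of phi and psi2 *)

(** For x_1 = s^m t^n and x_2 = u^m t^n the blocks [corner_mx] and [pair_mx] become permutation
    matrices. *)
Definition special_coef (A : nzRingType) m n (i : 'I_4) (j k : nat) : A :=
  match val i with
  | 0 => ((j == m) && (k == n))%:R
  | 1 => ((j == 0%N) && (k == n))%:R
  | _ => 0
  end.

Lemma if_natr (A : pzSemiRingType) (b c : bool) : (if b then c%:R else 0) = (b && c)%:R :> A.
Proof. by case: b. Qed.

Lemma isdet_special_corner (A : comNzRingType) m n :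
  isdet (@corner_mx A m n (special_coef A m n)) 1.
Proof.
apply: eq_isdet (isdet1 A _) => -[[y1 hy1] [y2 hy2]] [[x1 hx1] [x2 hx2]].
rewrite /corner_mx /toep /special_coef /= xpair_eqE -!val_eqE /=.
by rewrite if_natr; congr (nat_of_bool _)%:R; lia.
Qed.

Lemma isdet_special_pair (A : comNzRingType) m n :
  isdet (@pair_mx A m n (special_coef A m n)) 1.
Proof.
have h1 : (0 + m <= 2 * m)%N by lia.
have h2 : (m + m <= 2 * m)%N by lia.
have le : (2 * m <= m + m)%N by lia.
have bf := sum_case_swap (split_fst_bij n h1 h2 le).
have bid : bijective (@id ('I_(2 * m) * 'I_n)) by exists id.
apply: eq_isdet (isdet_reindex bid bf (isdet1 A _)) => -[[y1 hy1] [y2 hy2]].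
case=> -[[x1 hx1] [x2 hx2]];
  rewrite /pair_mx /toep /special_coef /= xpair_eqE -!val_eqE /=;
  rewrite if_natr; congr (nat_of_bool _)%:R; apply/andP/andP; lia.
Qed.

Section Monomials.
Variables (A : comNzRingType) (m n k l k2 l2 : nat) (a : 'I_m.+1 -> 'I_n.+1 -> A).
Hypotheses (ek : (k + m = k2)%N) (el : (l + n = l2)%N).

(** In a fixed bidegree the exponents of s and t determine those of u and v, so dehomogenizing loses
    nothing. *)
Lemma mcoeff_monomial_bipoly (x : bidx k l) (y : bidx k2 l2) :
  ('X_[bimon x] * bipoly a)@_(bimon y) = toep (extend a) y.1 y.2 x.1 x.2.
Proof.
have E (j : 'I_m.+1) (i : 'I_n.+1) : ((bimon x + bimon (j, i))%MM == bimon y) =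
    ((x.1 + j == y.1) && (x.2 + i == y.2))%N.
  apply/eqP/andP => [/mnmP e|[/eqP e1 /eqP e2]].
    have := e (inord 2); have := e (inord 0).
    by rewrite !mnmE !multinomE !(tnth_nth 0%N) !inordK //= => -> ->.
  apply/mnmP => q; rewrite mnmDE !multinomE !(tnth_nth 0%N) /=.
  have := ltn_ord x.1; have := ltn_ord x.2; have := ltn_ord j; have := ltn_ord i.
  by case: q => [[|[|[|[|//]]]] hq] /=; lia.
rewrite /bipoly big_distrr raddf_sum /=.
rewrite (eq_bigr (fun j : 'I_m.+1 => \sum_(i < n.+1) a j i * ((x.1 + j == y.1) && (x.2 + i == y.2))%N%:R)); last first.
  move=> j _; rewrite big_distrr raddf_sum; apply: eq_bigr => i _ /=.
  by rewrite -scalerAr mcoeffZ -mpolyXD mcoeffX E.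
rewrite /toep /extend.
case: ifP => [/andP[le1 le2]|nle]; last first.
  rewrite big1 // => j _; rewrite big1 // => i _.
  case: andP => [[/eqP e1 /eqP e2]|]; last by rewrite mulr0.
  by move: nle; rewrite -e1 -e2 !leq_addr.
case: ifP => [/andP[l1 l2']|nle]; last first.
  rewrite big1 // => j _; rewrite big1 // => i _.
  case: andP => [[/eqP e1 /eqP e2]|]; last by rewrite mulr0.
  by move: nle; rewrite -e1 -e2 !addKn !leq_ord.
rewrite (bigD1 (inord (y.1 - x.1))) //= (bigD1 (inord (y.2 - x.2))) //=.
rewrite !inordK // !subnKC // !eqxx mulr1 !big1 ?addr0 // => [j jj|i ii].
  rewrite big1 // => i _; case: andP => [[/eqP e1 _]|]; last by rewrite mulr0.
  by case/eqP: jj; apply: val_inj; rewrite /= -e1 addKn inordK.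
case: eqP => [e2|]; last by rewrite mulr0.
by case/eqP: ii; apply: val_inj; rewrite /= -e2 addKn inordK.
Qed.

Lemma monomial_bipoly (x : bidx k l) :
  'X_[bimon x] * bipoly a =
  \sum_(y : bidx k2 l2) toep (extend a) y.1 y.2 x.1 x.2 *: 'X_[bimon y].
Proof.
have h : bihomog k2 l2 ('X_[bimon x] * bipoly a).
  rewrite -ek -el; apply: bihomogM; first exact: bihomog_bimon.
  by apply: bihomog_sum => j; apply: bihomog_sum => i; apply/bihomogZ/bihomog_bimon.
rewrite (bihomogE h); apply: eq_bigr => y _; by rewrite mcoeff_monomial_bipoly.
Qed.
End Monomials.

Lemma phi_fammon m n (e : 'I_4 * bidx m.-1 n.-1) :
  phi (fammon (Defs.coefK m n) e) = 'X_[bimon e.2] * gpoly m n e.1.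
Proof.
rewrite /phi (bigD1 e.1) //= /fammon eqxx big1 ?addr0 // => i /negbTE ->.
by rewrite mul0r.
Qed.

Lemma psi2_fammon m n (e : Gamma0 * bidx m.-1 n.-1) :
  psi2 (fammon (Defs.coefK m n) e) = 'X_[bimon e.2] * gpolyX m n e.1.
Proof.
rewrite /psi2 (bigD1 e.1) //= /fammon eqxx big1 ?addr0 // => i /negbTE ->.
by rewrite mul0r.
Qed.

Lemma Gamma0_pair (g : Gamma0) : exists p : {p | ordered p},
  bmnm (val g) = (U_(widen34 (val p).1) + U_((val p).2))%MM.
Proof.
case: g => [w /= /andP[/eqP dw lw]].
have [i wi] : exists i, (0 < w i)%N.
  apply: NNPP => h; have : mdeg w = 0%N.
    rewrite mdegE big1 // => i _; apply/eqP; rewrite -leqn0 leqNgt.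
    by apply/negP => hi; apply: h; exists i.
  by rewrite dw.
have eU : (w - U_(i) + U_(i))%MM = w.
  by apply: submK; apply/mnm_lepP => j; rewrite mnm1E; case: eqP => [<-|].
have /eqP/mdeg1P[j /eqP ej] : mdeg (w - U_(i))%MM = 1%N.
  by have := congr1 mdeg eU; rewrite mdegD mdeg1 dw addn1 => -[].
rewrite ej in eU.
wlog ji : i j eU {wi ej} / (j <= i)%N.
  move=> H; case: (leqP j i) => [|/ltnW] le; first exact: (H i j).
  by apply: (H j i) => //; rewrite addmC.
(* If j were the last index, so would be i >= j, and x_4 would have exponent 2. *)
have j3 : (j < 3)%N.
  rewrite ltn_neqAle -ltnS ltn_ord andbT; apply: contraTneq lw => ej.
  have ij : i = ord_max.
    by apply: val_inj => /=; move: ej ji (ltn_ord i) => /eqP; lia.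
  by rewrite -eU mnmDE !mnm1E ij -!val_eqE /= ej.
by exists (Sub (Ordinal j3, i) ji) => /=; rewrite -eU; congr (U_(_) + _)%MM; apply: val_inj.
Qed.

Lemma gpolyX_pair m n g (p : 'I_3 * 'I_4) :
  bmnm (val g) = (U_(widen34 p.1) + U_(p.2))%MM ->
  gpolyX m n g = gpoly m n p.2 * gpoly m n (widen34 p.1).
Proof.
move=> e; rewrite /gpolyX e.
have U i : \prod_(j < 4) gpoly m n j ^+ (U_(i)%MM j) = gpoly m n i.
  rewrite (bigD1 i) //= mnm1E eqxx expr1 big1 ?mulr1 // => j ji.
  by rewrite mnm1E eq_sym (negbTE ji) expr0.
by under eq_bigr do rewrite mnmDE exprD; rewrite big_split /= !U mulrC.
Qed.

Lemma extend_special (A : nzRingType) m n i j k :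
  extend (fun (j : 'I_m.+1) (k : 'I_n.+1) => special_coef A m n i j k) j k =
  special_coef A m n i j k.
Proof.
rewrite /extend; case: ifP => [/andP[jm kn]|]; first by rewrite !inordK.
rewrite /special_coef; case: (val i) => [|[|?]] // H.
  by rewrite (_ : _ && _ = false) //; apply/negbTE; move: H; lia.
by rewrite (_ : _ && _ = false) //; apply/negbTE; move: H; lia.
Qed.

Section Generic.
Variables m n : nat.
Local Notation A0 := {mpoly rat[#|cidx 4 m n|]}.

Definition gcoef (i : 'I_4) (j : 'I_m.+1) (k : 'I_n.+1) : A0 :=
  'X_(enum_rank ((i, j, k) : cidx 4 m n)).

(** This allows the common factor in [koszul_det] to be cancelled: at [special_coef] both
    determinants are +-1. *)
Lemma generic_det_neq0 g1 g2 :
  isdet (corner_mx (m := m) (n := n) (fun i => extend (gcoef i))) g1 ->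
  isdet (pair_mx (m := m) (n := n) (fun i => extend (gcoef i))) g2 -> g2 * g1 != 0.
Proof.
pose ev : {rmorphism A0 -> rat} :=
  meval (fun q => let ijk : cidx 4 m n := enum_val q in special_coef rat m n ijk.1.1 ijk.1.2 ijk.2).
have evT i y1 y2 x1 x2 : ev (toep (extend (gcoef i)) y1 y2 x1 x2) =
    toep (special_coef rat m n i) y1 y2 x1 x2.
  rewrite toep_map ?rmorph0 //; apply: eq_toep => j k.
  rewrite extend_map ?rmorph0 // -[RHS]extend_special /extend.
  by case: ifP => // _; rewrite /ev /= mevalXU enum_rankK.
have nz (d : A0) : eqpm (ev d) 1 -> d != 0.
  move=> h; apply/eqP => d0; move: h; rewrite d0 rmorph0.
  by case=> /eqP; rewrite eq_sym ?oppr_eq0 oner_eq0.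
move=> /(isdet_map ev) h1 /(isdet_map ev) h2; apply: mulf_neq0; apply: nz.
  apply: isdet_uniq (isdet_special_pair rat m n); apply: eq_isdet h2 => y [x|x]; exact: evT.
apply: isdet_uniq (isdet_special_corner rat m n); apply: eq_isdet h1 => y x; exact: evT.
Qed.

End Generic.

Theorem corollary3p10 (m n : nat) (hm : (0 < m)%N) (hn : (0 < n)%N)
  (domP : 'I_(4 * m * n) -> 'I_4 * bidx m.-1 n.-1)
  (codP : 'I_(4 * m * n) -> bidx (2 * m).-1 (2 * n).-1)
  (domS : 'I_(9 * m * n) -> Gamma0 * bidx m.-1 n.-1)
  (codS : 'I_(9 * m * n) -> bidx (3 * m).-1 (3 * n).-1)
  (hdomP : bijective domP) (hcodP : bijective codP)
  (hdomS : bijective domS) (hcodS : bijective codS)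
  (Res : {mpoly int[#|cidx 3 m n|]}) (hRes : is_biresultant Res) :
  \det (MS2 domS codS) = \det (MP domP codP) ^+ 3 * res_gpoly Res \/
  \det (MS2 domS codS) = - (\det (MP domP codP) ^+ 3 * res_gpoly Res).
Proof.
case: m hm domP codP domS codS hdomP hcodP hdomS hcodS Res hRes => // m _.
case: n hn => // n _ domP codP domS codS hdomP hcodP hdomS hcodS Res hRes.
set M := m.+1 in domP codP domS codS hdomP hcodP hdomS hcodS Res hRes *.
set N := n.+1 in domP codP domS codS hdomP hcodP hdomS hcodS Res hRes *.
(* The argument runs in Q[c] rather than in its fraction field, because the coefficients can be
   specialized there; [th] transports the result. *)
pose A0 := {mpoly rat[#|cidx 4 M N|]}.
pose th : {rmorphism A0 -> Defs.coefK M N} := @tofrac A0.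
pose c i := extend (@gcoef M N i).
have supp i j k : (M < j)%N || (N < k)%N -> c i j k = 0 by apply: extend_out.
have toepE i y1 y2 x1 x2 :
    th (toep (c i) y1 y2 x1 x2) = toep (extend (@coefc M N i)) y1 y2 x1 x2.
  by rewrite toep_map ?rmorph0 //; apply: eq_toep => j k; rewrite extend_map ?rmorph0.
have [P0 hP0] := isdet_exists (phi_mx (m := M) (n := N) c)
  (ltac:(rewrite !card_prod !card_ord; nia)).
have [s0 hs0] := isdet_exists (msq_mx (m := M) (n := N) c)
  (ltac:(rewrite !card_prod card_ordered !card_ord; nia)).
have [g1 hg1] := isdet_exists (corner_mx (m := M) (n := N) c) erefl.
have [g2 hg2] := isdet_exists (pair_mx (m := M) (n := N) c)
  (ltac:(rewrite card_sum !card_prod !card_ord; nia)).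
have [R0 hR0] := isdet_exists (sylc (@ucoef M N))
  (ltac:(rewrite !card_prod !card_ord; nia)).
have hr0 := isdet_eval hR0 (fun i => @gcoef M N (widen34 i)).
set r0 := eval_hom _ R0 in hr0.
have key : eqpm s0 (P0 ^+ 3 * r0).
  have g0 := generic_det_neq0 hg1 hg2.
  have := koszul_det supp hP0 hs0 hr0 hg1 hg2.
  case=> e; [left|right]; apply: (mulIf g0); rewrite e; ring.
have detP : eqpm (\det (MP domP codP)) (th P0).
  apply: eqpm_sym; apply: eqpm_trans (isdetE (isdet_map th hP0) hcodP hdomP) _.
  left; congr (\det _); apply/matrixP => r q; rewrite !mxE phi_fammon.
  by rewrite /gpoly mcoeff_monomial_bipoly ?toepE //; rewrite /M /N; lia.
have detS : eqpm (\det (MS2 domS codS)) (th s0).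
  have [f fP] := fin_all_exists Gamma0_pair.
  have f_inj : injective f.
    by move=> g g' e; apply/val_inj/val_inj; have := fP g; rewrite e -fP.
  (* The cardinality is read off the bijection [domS] from a set of 9MN elements to [Gamma0] times
     MN monomials. *)
  have cardG : #|Gamma0| = 9%N.
    have := bij_eq_card hdomS; rewrite card_prod !card_ord card_prod !card_ord.
    by rewrite /M /N; nia.
  have f_bij : bijective f by apply: inj_card_bij => //; rewrite card_ordered cardG.
  pose h (x : Gamma0 * ('I_M * 'I_N)) := (f x.1, x.2).
  have h_bij : bijective h.
    case: f_bij => fi fK Kf; exists (fun x => (fi x.1, x.2)).
      by case=> x1 x2; rewrite /h /= fK.
    by case=> x1 x2; rewrite /h /= Kf.
  apply: eqpm_sym.
  apply: eqpm_trans (isdetE (isdet_map th hs0) hcodS (bij_comp h_bij hdomS)) _.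
  left; congr (\det _); apply/matrixP => r q; rewrite !mxE psi2_fammon /=.
  rewrite (gpolyX_pair M N (fP _)) mulrA /gpoly.
  rewrite (monomial_bipoly (k2 := (2 * M).-1) (l2 := (2 * N).-1)); try by rewrite /M /N; lia.
  rewrite big_distrl raddf_sum /msq_mx [RHS]raddf_sum; apply: eq_bigr => y _ /=.
  rewrite -scalerAl mcoeffZ mcoeff_monomial_bipoly; try by rewrite /M /N; lia.
  by rewrite rmorphM mulrC !toepE.
have detR : eqpm (th r0) (res_gpoly Res).
  rewrite /r0 eval_hom_comp.
  exact: (eqpm_map (eval_hom _) (sylvester_resultant _ _ hR0 hRes)).
apply: eqpm_trans detS _; apply: eqpm_trans (eqpm_map th key) _.
rewrite rmorphM rmorphXn; apply: eqpmM detR; apply: eqpmX; exact: eqpm_sym.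
Qed.
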